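(* Let $n:=\max\{|i| : i\in I\}$ and let $f:\mathbb{R}^e\to\mathbb{R}$ be of class $C^{n+2}$. (i) For every $(\alpha,\beta)$ rough path $\mathbb{X}\in\Omega_{(\alpha,\beta)\text{-Hld}}$, the $(\alpha,\beta)$ rough path integral $\int f(\hat{\mathbb{X}})\,\mathrm{d}\mathbb{X}=(Y^{(1)},Y^{(2)})$ is well-defined (i.e. the defining limits exist for all $(s,t)\in\Delta_T$), and $\int f(\hat{\mathbb{X}})\,\mathrm{d}\mathbb{X}\in\Omega_{\alpha\text{-Hld}}$. (ii) The integration map $\int:\Omega_{(\alpha,\beta)\text{-Hld}}\to\Omega_{\alpha\text{-Hld}}$, $\mathbb{X}\mapsto\int f(\hat{\mathbb{X}})\,\mathrm{d}\mathbb{X}$, is locally Lipschitz continuous. More precisely, for every $M>0$ there is a constant $C>0$ such that $$d_\alpha\Big(\int f(\hat{\mathbb{V}})\,\mathrm{d}\mathbb{V},\ \int f(\hat{\mathbb{W}})\,\mathrm{d}\mathbb{W}\Big)\le C\,d_{(\alpha,\beta)}(\mathbb{V},\mathbb{W})\qquad\text{for all }\mathbb{V},\mathbb{W}\in\mathcal{E}_M,$$ where $\mathcal{E}_M:=\{\mathbb{X}\in\Omega_{(\alpha,\beta)\text{-Hld}} : |||\mathbb{X}|||_{(\alpha,\beta)}\le M\}$.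
   Context: Fix integers $d,e\ge1$, and $T>0$, $\alpha\in(\frac13,\frac12]$, $\beta\in(0,\frac12)$. $\mathbb{Z}_+$ is the set of nonnegative integers. For multi-indices $i=(i_1,\dots,i_e)\in\mathbb{Z}_+^e$ and $x\in\mathbb{R}^e$: $|i|=\sum_l i_l$, $i!=\prod_l i_l!$, $x^i=\prod_l x_l^{i_l}$ (with $0^0=1$), $\partial^i=\prod_l(\partial/\partial x_l)^{i_l}$; $p\le i$ means $p_l\le i_l$ for all $l$. Put $\Delta_T=\{(s,t):0\le s\le t\le T\}$, $$I=\{i\in\mathbb{Z}_+^e: |i|\beta+\alpha\le1\},\qquad J=\{(j,k)\in\mathbb{Z}_+^e\times\mathbb{Z}_+^e: |j+k|\beta+2\alpha\le1\}.$$ For a two-parameter function $A$ on $\Delta_T$ and $\gamma\in(0,1]$, $\|A\|_{\gamma\text{-Hld}}=\sup_{0\le s<t\le T}|A_{st}|/|t-s|^\gamma$. **$(\alpha,\beta)$ rough path.** $\mathbb{X}=(\hat X,X^{(i)},\mathbf{X}^{(jk)})_{i\in I,(j,k)\in J}$ is an $(\alpha,\beta)$ rough path if these are functions on $\Delta_T$ such that, for all $i\in I$, $(j,k)\in J$, $s\le u\le t$: (1) $\hat X$ is $\mathbb{R}^e$-valued, $X^{(i)}$ is $\mathbb{R}^d$-valued, $\mathbf{X}^{(jk)}$ is $\mathbb{R}^d\otimes\mathbb{R}^d$-valued; (2) (modified Chen's relation) $\hat X_{st}=\hat X_{su}+\hat X_{ut}$, $$X^{(i)}_{st}=X^{(i)}_{su}+\sum_{p\le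 i}\frac{1}{(i-p)!}(\hat X_{su})^{i-p}X^{(p)}_{ut},$$ $$\mathbf{X}^{(jk)}_{st}=\mathbf{X}^{(jk)}_{su}+\sum_{q\le k}\frac{1}{(k-q)!}(\hat X_{su})^{k-q}X^{(j)}_{su}\otimes X^{(q)}_{ut}+\sum_{p\le j}\sum_{q\le k}\frac{1}{(j-p)!(k-q)!}(\hat X_{su})^{j+k-p-q}\mathbf{X}^{(pq)}_{ut};$$ (3) $\|\hat X\|_{\beta\text{-Hld}}$, $\|X^{(i)}\|_{|i|\beta+\alpha\text{-Hld}}$, $\|\mathbf{X}^{(jk)}\|_{|j+k|\beta+2\alpha\text{-Hld}}$ are finite. The set of these is $\Omega_{(\alpha,\beta)\text{-Hld}}$, with metric $$d_{(\alpha,\beta)}(\mathbb{X},\mathbb{Y})=\|\hat X-\hat Y\|_{\beta\text{-Hld}}+\sum_{i\in I}\|X^{(i)}-Y^{(i)}\|_{|i|\beta+\alpha\text{-Hld}}+\sum_{(j,k)\in J}\|\mathbf{X}^{(jk)}-\mathbf{Y}^{(jk)}\|_{|j+k|\beta+2\alpha\text{-Hld}}$$ and homogeneous norm $$|||\mathbb{X}|||_{(\alpha,\beta)}=\|\hat X\|_{\beta\text{-Hld}}+\sum_{i\in I}\big(\|X^{(i)}\|_{|i|\beta+\alpha\text{-Hld}}\big)^{1/(|i|+1)}+\sum_{(j,k)\in J}\big(\|\mathbf{X}^{(jk)}\|_{|j+k|\beta+2\alpha\text{-Hld}}\big)^{1/(|j+k|+2)}.$$ **$(\alpha,\beta)$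 rough path integral.** With $\hat x_s:=\hat X_{0s}$ and $\mathcal{P}=\{s=t_0<\dots<t_N=t\}$ ranging over partitions of $[s,t]$ with mesh $|\mathcal{P}|\to0$, set (if the limits exist) $$Y^{(1)}_{st}=\lim_{|\mathcal{P}|\searrow0}\sum_{p=1}^N\sum_{i\in I}\partial^if(\hat x_{t_{p-1}})X^{(i)}_{t_{p-1}t_p},$$ $$Y^{(2)}_{st}=\lim_{|\mathcal{P}|\searrow0}\sum_{p=1}^N\Big(Y^{(1)}_{t_0t_{p-1}}\otimes Y^{(1)}_{t_{p-1}t_p}+\sum_{(j,k)\in J}\partial^jf(\hat x_{t_{p-1}})\partial^kf(\hat x_{t_{p-1}})\mathbf{X}^{(jk)}_{t_{p-1}t_p}\Big),$$ and $\int f(\hat{\mathbb{X}})\,\mathrm{d}\mathbb{X}:=(Y^{(1)},Y^{(2)})$. **$\alpha$-Hölder rough paths.** $\Omega_{\alpha\text{-Hld}}$ is the set of pairs $(Y^{(1)},Y^{(2)})$ of functions on $\Delta_T$ with values in $\mathbb{R}^d$ and $\mathbb{R}^d\otimes\mathbb{R}^d$ satisfying Chen's relation $Y^{(1)}_{st}=Y^{(1)}_{su}+Y^{(1)}_{ut}$, $Y^{(2)}_{st}=Y^{(2)}_{su}+Y^{(2)}_{ut}+Y^{(1)}_{su}\otimes Y^{(1)}_{ut}$ and $\|Y^{(1)}\|_{\alpha\text{-Hld}},\|Y^{(2)}\|_{2\alpha\text{-Hld}}<\infty$, with metric $d_\alpha(Y,Z)=\|Y^{(1)}-Z^{(1)}\|_{\alpha\text{-Hld}}+\|Y^{(2)}-Z^{(2)}\|_{2\alpha\text{-Hld}}$.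 *)

(* Defs.v *)
From HB Require Import structures.
From mathcomp Require Import all_boot all_order all_algebra.
From mathcomp Require Import all_classical all_reals all_analysis.

Set Implicit Arguments.
Unset Strict Implicit.
Unset Printing Implicit Defensive.

Import Order.TTheory GRing.Theory Num.Theory.
Import numFieldNormedType.Exports.

Local Open Scope classical_set_scope.
Local Open Scope ring_scope.

Notation mindex e := {ffun 'I_e -> nat}.

Section MultiIndex.
Variable e : nat.
Implicit Types i p : mindex e.

Definition mdeg i : nat := (\sum_(l < e) i l)%N.

Definition mfact i : nat := (\prod_(l < e) (i l)`!)%N.

Definition mle p i : Prop := forall l, (p l <= i l)%N.

(* Truncated subtraction: only used as [msub i p] with [mle p i]. *)
Definition msub i p : mindex e := [ffun l => (i l - p l)%N].

Definition mpow (R : pzRingType) (x : 'rV[R]_e) i : R :=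
  \prod_(l < e) x 0 l ^+ i l.

(* The sums [\sum_(i \in A) F i] below are the finitely supported sums of
   fsbigop, which are 0 by convention when infinitely many terms are nonzero;
   [finite_mle], [finite_idxI] and [finite_idxJ] exclude that case. *)
Lemma finite_mbounded (N : nat) :
  finite_set [set i : mindex e | forall l, (i l <= N)%N].
Proof.
pose h (g : {ffun 'I_e -> 'I_N.+1}) : mindex e := [ffun l => val (g l)].
apply: (@sub_finite_set _ _ (h @` setT)); last first.
  by apply: finite_image; exact: finite_finset.
move=> i /= iN; exists [ffun l => inord (i l)] => //.
by apply/ffunP => l; rewrite !ffunE /= inordK// ltnS.
Qed.

Lemma leq_mdeg i l : (i l <= mdeg i)%N.
Proof. by rewrite /mdeg (bigD1 l)//= leq_addr. Qed.

Lemma finite_mle i : finite_set [set p | mle p i].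
Proof.
apply: (sub_finite_set _ (finite_mbounded (mdeg i))) => p /= pi l.
exact: leq_trans (pi l) (leq_mdeg i l).
Qed.

End MultiIndex.

Section IndexSets.
Variables (R : realType) (e : nat) (alpha beta : R).

Definition idxI : set (mindex e) :=
  [set i | (mdeg i)%:R * beta + alpha <= 1].

Definition idxJ : set (mindex e * mindex e) :=
  [set jk | (mdeg (jk.1 + jk.2))%:R * beta + 2 * alpha <= 1].

Let finite_idx (c : R) : 0 < beta -> 0 <= c ->
  finite_set [set i : mindex e | (mdeg i)%:R * beta + c <= 1].
Proof.
move=> b0 c0; have [N bN] : exists N : nat, beta^-1 <= N%:R.
  by exists (Num.truncn beta^-1).+1; rewrite ltW// truncnS_gt.
apply: (sub_finite_set _ (finite_mbounded e N)) => i /= iI l.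
apply: leq_trans (leq_mdeg i l) _.
rewrite -(ler_nat R) (le_trans _ bN)// -[leRHS]mul1r ler_pdivlMr//.
by rewrite (le_trans _ iI)// lerDl.
Qed.

Lemma finite_idxI : 0 < beta -> 0 <= alpha -> finite_set idxI.
Proof. exact: finite_idx. Qed.

Lemma finite_idxJ : 0 < beta -> 0 <= alpha -> finite_set idxJ.
Proof.
move=> b0 a0; have a20 : 0 <= 2 * alpha by rewrite mulr_ge0.
apply: (sub_finite_set _ (finite_setX (finite_idx b0 a20) (finite_idx b0 a20))).
move=> [j k] /= jkJ; have degD : mdeg (j + k) = (mdeg j + mdeg k)%N.
  by rewrite /mdeg -big_split; apply: eq_bigr => l _; rewrite ffunE.
by split=> /=; apply: le_trans jkJ; rewrite lerD2r;
  apply: ler_wpM2r (ltW b0) _ _ _; rewrite ler_nat degD ?leq_addr ?leq_addl.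
Qed.

End IndexSets.

Section Derivatives.
Variables (R : realType) (e : nat).
Implicit Type f : 'rV[R]_e -> R.

Definition partial (l : 'I_e) f : 'rV[R]_e -> R :=
  fun x => 'D_(delta_mx 0 l : 'rV[R]_e) f x.

(* The partial derivatives are iterated in a fixed order, the innermost one
   being along the last coordinate. *)
Definition mpartial (i : mindex e) f : 'rV[R]_e -> R :=
  foldr (fun l g => iter (i l) (partial l) g) f (enum 'I_e).

Fixpoint classC (k : nat) f : Prop :=
  match k with
  | 0 => continuous f
  | k'.+1 => continuous f /\
      forall l, (forall x, derivable f x (delta_mx 0 l : 'rV[R]_e)) /\
                classC k' (partial l f)
  end.

End Derivatives.

Section Holder.
Variable R : realType.

(* Euclidean norm on row vectors, Hilbert-Schmidt norm on matrices. It is not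
   the sup norm which the library puts on matrices; the topology is the same. *)
Definition euclid_norm m n (A : 'M[R]_(m, n)) : R :=
  Num.sqrt (\sum_(a < m) \sum_(b < n) A a b ^+ 2).

(* Two-parameter functions are total; only their values on the simplex
   0 <= s <= t <= T matter. *)
Definition simplex (T : R) : set (R * R) :=
  [set st | [/\ 0 <= st.1, st.1 <= st.2 & st.2 <= T]].

Definition holder m n (T gamma : R) (A : R -> R -> 'M[R]_(m, n)) : \bar R :=
  ereal_sup [set x | exists s t, [/\ 0 <= s, s < t, t <= T &
    x = (euclid_norm (A s t) / `|t - s| `^ gamma)%:E]].

Definition dholder m n (T gamma : R) (A B : R -> R -> 'M[R]_(m, n)) : \bar R :=
  holder T gamma (fun s t => A s t - B s t).

End Holder.

(* R^d (x) R^d is identified with d x d matrices: (x (x) y)_(a,b) = x_a y_b. *)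
Definition tensor (R : realType) d (x y : 'rV[R]_d) : 'M[R]_d := x^T *m y.

(* Components with index outside I or J are present but never used. *)
Record path_data (R : realType) (d e : nat) := PathData {
  hatX : R -> R -> 'rV[R]_e;
  fstX : mindex e -> R -> R -> 'rV[R]_d;
  sndX : mindex e -> mindex e -> R -> R -> 'M[R]_d }.

Section RoughPaths.
Variables (R : realType) (d e : nat) (T alpha beta : R).
Implicit Types X Y : path_data R d e.

Let I : set (mindex e) := idxI alpha beta.
Let J : set (mindex e * mindex e) := idxJ alpha beta.

Definition chen_hat X : Prop := forall s u t, 0 <= s <= u -> u <= t <= T ->
  hatX X s t = hatX X s u + hatX X u t.

Definition chen_fst X : Prop := forall i, I i ->
  forall s u t, 0 <= s <= u -> u <= t <= T ->
  fstX X i s t = fstX X i s u +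
    \sum_(p \in [set p | mle p i])
      ((mfact (msub i p))%:R^-1 * mpow (hatX X s u) (msub i p))
        *: fstX X p u t.

Definition chen_snd X : Prop := forall j k, J (j, k) ->
  forall s u t, 0 <= s <= u -> u <= t <= T ->
  sndX X j k s t = sndX X j k s u +
    \sum_(q \in [set q | mle q k])
      ((mfact (msub k q))%:R^-1 * mpow (hatX X s u) (msub k q))
        *: tensor (fstX X j s u) (fstX X q u t) +
    \sum_(p \in [set p | mle p j]) \sum_(q \in [set q | mle q k])
      (((mfact (msub j p))%:R * (mfact (msub k q))%:R)^-1 *
         mpow (hatX X s u) (msub (msub (j + k) p) q))
        *: sndX X p q u t.

Let expI (i : mindex e) : R := (mdeg i)%:R * beta + alpha.
Let expJ (jk : mindex e * mindex e) : R :=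
  (mdeg (jk.1 + jk.2))%:R * beta + 2 * alpha.

Definition holder_bounds X : Prop :=
  [/\ (holder T beta (hatX X) < +oo)%E,
      forall i, I i -> (holder T (expI i) (fstX X i) < +oo)%E &
      forall jk, J jk ->
        (holder T (expJ jk) (sndX X jk.1 jk.2) < +oo)%E].

Definition ab_rough_path : set (path_data R d e) :=
  [set X | [/\ chen_hat X, chen_fst X, chen_snd X & holder_bounds X]].

Definition ab_dist X Y : \bar R :=
  (dholder T beta (hatX X) (hatX Y) +
   \sum_(i \in I) dholder T (expI i) (fstX X i) (fstX Y i) +
   \sum_(jk \in J)
     dholder T (expJ jk) (sndX X jk.1 jk.2) (sndX Y jk.1 jk.2))%E.

Definition ab_hnorm X : \bar R :=
  (holder T beta (hatX X) +
   \sum_(i \in I) holder T (expI i) (fstX X i) `^ ((mdeg i).+1%:R^-1)%R +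
   \sum_(jk \in J)
     holder T (expJ jk) (sndX X jk.1 jk.2)
       `^ ((mdeg (jk.1 + jk.2)).+2%:R^-1)%R)%E.

Let rpair := ((R -> R -> 'rV[R]_d) * (R -> R -> 'M[R]_d))%type.

Definition a_rough_path : set rpair :=
  [set Y | [/\ forall s u t, 0 <= s <= u -> u <= t <= T ->
                 Y.1 s t = Y.1 s u + Y.1 u t,
               forall s u t, 0 <= s <= u -> u <= t <= T ->
                 Y.2 s t = Y.2 s u + Y.2 u t + tensor (Y.1 s u) (Y.1 u t),
               (holder T alpha Y.1 < +oo)%E &
               (holder T (2 * alpha) Y.2 < +oo)%E]].

Definition a_dist (Y Z : rpair) : \bar R :=
  (dholder T alpha Y.1 Z.1 + dholder T (2 * alpha) Y.2 Z.2)%E.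

End RoughPaths.

Section Integral.
Variables (R : realType) (d e : nat) (alpha beta : R).
Variables (f : 'rV[R]_e -> R) (X : path_data R d e).

(* As in [itv_partition], a partition s = t_0 < ... < t_N = t is represented by
   the sequence [:: t_1; ...; t_N]; [pt s r p] is then t_p. *)
Definition pt (s : R) (r : seq R) (p : nat) : R := nth s (s :: r) p.

Definition mesh (s : R) (r : seq R) : R :=
  \big[Num.max/0]_(0 <= p < size r) (pt s r p.+1 - pt s r p).

(* The filter of |P| -> 0 along the partitions P of [s, t]. *)
Definition mesh_to0 (s t : R) : set_system (seq R) :=
  filter_from [set delta : R | 0 < delta]
    (fun delta => [set r | itv_partition s t r /\ mesh s r < delta]).

Definition xhat (s : R) : 'rV[R]_e := hatX X 0 s.

Definition riemann1 (s : R) (r : seq R) : 'rV[R]_d :=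
  \sum_(0 <= p < size r)
    \sum_(i \in idxI alpha beta)
      mpartial i f (xhat (pt s r p)) *: fstX X i (pt s r p) (pt s r p.+1).

Definition rough_integral1 (s t : R) : 'rV[R]_d := lim (riemann1 s @ mesh_to0 s t).

Definition riemann2 (s : R) (r : seq R) : 'M[R]_d :=
  \sum_(0 <= p < size r)
    (tensor (rough_integral1 s (pt s r p)) (rough_integral1 (pt s r p) (pt s r p.+1)) +
     \sum_(jk \in idxJ alpha beta)
       (mpartial jk.1 f (xhat (pt s r p)) * mpartial jk.2 f (xhat (pt s r p)))
         *: sndX X jk.1 jk.2 (pt s r p) (pt s r p.+1)).

Definition rough_integral2 (s t : R) : 'M[R]_d := lim (riemann2 s @ mesh_to0 s t).

Definition rough_integral := (rough_integral1, rough_integral2).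

Definition rough_integral_exists (T : R) : Prop :=
  forall s t, simplex T (s, t) ->
    cvg (riemann1 s @ mesh_to0 s t) /\ cvg (riemann2 s @ mesh_to0 s t).

End Integral.

(* Main.v *)
Require Import Defs.
From HB Require Import structures.
From mathcomp Require Import all_boot all_order all_algebra.
From mathcomp Require Import finmap.
From mathcomp Require Import all_classical all_reals all_analysis.
From mathcomp Require Import ring lra zify.
Import Order.TTheory GRing.Theory Num.Theory.
Import numFieldNormedType.Exports.
Local Open Scope classical_set_scope.
Local Open Scope ring_scope.

(** Both levels of the integral are obtained by sewing: a functional A(s, t), here
    called a germ, whose additive defect A(s, t) - A(s, u) - A(u, t) is bounded by
    K (t - s)^theta with theta > 1, has convergent Riemann sums, and the limit
    differs from A(s, t) by at most C K (t - s)^theta ([sewing_cvg],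
    [sewing_maximal]).

    The germ of the first level is the sum over i of d^i f(x_s) X^(i)_st, where
    x_s stands for hatX_0s. The modified Chen relation expands X^(i)_st around an
    intermediate time u in monomials of hatX_su, and the sum collects into Taylor
    polynomials at x_s of the derivatives d^p f evaluated at x_u = x_s + hatX_su.
    Hence the defect is a sum of products of X^(p)_ut with a Taylor remainder of
    order n + 1 - |p| ([germ1_defect]). The two factors have orders
    |p| beta + alpha and (n + 1 - |p|) beta, so that the defect has order
    (n + 1) beta + alpha, which exceeds 1 because n is maximal.

    The germ of the second level is, for a base point r, the tensor product of
    Y^(1)_rs and Y^(1)_st plus the sum over J of d^j f(x_s) d^k f(x_s) X^(jk)_st.
    Its defect does not depend on r. The part of the defect that comes from Chen's
    relation for X^(jk) contains the truncated product of the first level germs on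
    [s, u] and on [u, t]; subtracting the product of Y^(1)_su and Y^(1)_ut cancels
    it up to terms of order M beta + 2 alpha > 1, where M is the first degree
    outside J ([germ2_defect], [lipO_defect2]). Chen's relation for Y^(2) holds
    because the germs based at s and at u differ by an additive functional
    ([int2_chen]).

    Local Lipschitz continuity comes along with the bounds. A family of quantities
    is recorded together with its order g and one constant C such that, for paths X
    and Y with components bounded by K and within eps of each other, the quantity
    of X is at most C (t - s)^g and the quantities of X and Y differ by at most
    C eps (t - s)^g ([lipO]). Such families are stable under sums, products and,
    sewing being linear in the germ, under sewing ([lipO_sewing]). It remains to
    see that Taylor remainders form such families ([taylor_rem_bound]); the last of
    the n + 2 derivatives of f serves for the Lipschitz bound. Boundedness of the
    integral of a single path X is the case Y = X, eps = 0. *)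

Set Implicit Arguments.
Unset Strict Implicit.
Unset Printing Implicit Defensive.

(** * Riemann sums of a germ and the maximal inequality *)
Section Sewing.
Variable R : realType.
Implicit Types (A B : R -> R -> R) (r P Q : seq R).

(** The recursive form follows the induction on partitions; [sum_pt] relates it to
    sums over the positions of the partition points. *)
Fixpoint rsum A s r : R := if r is a :: r' then A s a + rsum A a r' else 0.

Lemma rsum_cat A s r1 r2 : rsum A s (r1 ++ r2) = rsum A s r1 + rsum A (last s r1) r2.
Proof. by elim: r1 s => [|a r1 IH] s /=; rewrite ?add0r// IH addrA. Qed.

Lemma rsumB A B s r : rsum (fun x y => A x y - B x y) s r = rsum A s r - rsum B s r.
Proof. by elim: r s => [|a r IH] s /=; rewrite ?subr0// IH; ring. Qed.

Lemma sum_pt (G : R -> R -> R) s r :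
  \sum_(0 <= p < size r) G (pt s r p) (pt s r p.+1) = rsum G s r.
Proof.
elim: r s => [|a r IH] s /=; first by rewrite big_nil.
rewrite big_nat_recl//= -IH; congr (_ + _).
apply: eq_big_nat => p /andP[_ pr]; rewrite /pt /=; congr (G _ _).
  by apply: set_nth_default; exact: ltnW.
exact: set_nth_default.
Qed.

Lemma rsum_ext (G G' : R -> R -> R) s t r : itv_partition s t r ->
  (forall u v, s <= u -> u <= v -> v <= t -> G u v = G' u v) -> rsum G s r = rsum G' s r.
Proof.
elim: r s => //= a r IH s pr h; have pr' := itv_partition_cons pr.
have sa : s <= a by case: pr => /= /andP[+ _] _; exact: ltW.
have at_ := itv_partition_le pr'.
rewrite h// (IH a)// => u v au; apply: h; exact: le_trans au.
Qed.

Lemma split_partition_at s r m : r != [::] -> s <= m <= last s r ->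
  exists r1 a r2, [/\ r = r1 ++ a :: r2, last s r1 <= m & m <= a].
Proof.
elim: r s => // a r IH s _ /=; have [ma|am] := leP m a => /andP[sm ml].
  by exists [::], a, r.
have [|r0] := eqVneq r [::].
  by move=> r0; move: ml; rewrite r0 /= => /(lt_le_trans am); rewrite ltxx.
have [|r1 [b [r2 [-> l1 l2]]]] := IH a r0; first by rewrite (ltW am).
by exists (a :: r1), b, r2.
Qed.

(** The solution c of c = 2 (1/2)^theta c + 2, the recursion of the midpoint
    argument below. *)
Definition sewing_const (theta : R) := 2 / (1 - 2 * 2^-1 `^ theta).

Lemma half_powR_lt (theta : R) : 1 < theta -> 0 < 1 - 2 * 2^-1 `^ theta :> R.
Proof.
move=> t1; have t0 : 0 < theta by lra.
have h : 2^-1 `^ (theta - 1) < 1 :> R.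
  rewrite -[ltRHS](_ : 1 `^ (theta - 1) = 1); last by rewrite powR1.
  by apply: gt0_ltr_powR; rewrite ?nnegrE; lra.
by rewrite -(@mulr_powRB1 _ (2^-1))//; lra.
Qed.

(** Splitting a partition at the interval that contains the midpoint replaces
    one estimate at scale t - s by two estimates at scale (t - s) / 2, at the
    price of two defects; since 2 (1/2)^theta < 1, the constant reproduces
    itself. *)
Lemma sewing_maximal_diag0 A (lo hi theta K : R) :
  1 < theta -> 0 <= K -> (forall s, A s s = 0) ->
  (forall s u t, lo <= s -> s < u -> u < t -> t <= hi ->
    `|A s t - A s u - A u t| <= K * (t - s) `^ theta) ->
  forall r (s t : R), lo <= s -> t <= hi -> itv_partition s t r ->
  `|rsum A s r - A s t| <= sewing_const theta * K * (t - s) `^ theta.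
Proof.
move=> t1 K_ge0 A0 defect.
set c := sewing_const theta.
have c_ge0 : 0 <= c by rewrite divr_ge0// ltW// half_powR_lt.
have defectW (s u t : R) : lo <= s -> s <= u -> u <= t -> t <= hi ->
    `|A s t - A s u - A u t| <= K * (t - s) `^ theta.
  move=> ls; rewrite le_eqVlt => /predU1P[<- _ _|su].
    by rewrite A0 subr0 subrr normr0; exact: mulr_ge0 (powR_ge0 _ _).
  rewrite le_eqVlt => /predU1P[<- _|ut th]; last exact: defect.
  by rewrite A0 subr0 subrr normr0; exact: mulr_ge0 (powR_ge0 _ _).
move=> r; have [n] := ubnP (size r); elim: n r => // n IH r rn s t ls th P.
have [r0|r0] := eqVneq r [::].
  move: P; rewrite r0 => /itv_partition_nil <-; rewrite A0 /= subr0 normr0.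
  exact: mulr_ge0 (mulr_ge0 c_ge0 K_ge0) (powR_ge0 _ _).
have st := itv_partition_le P.
have /eqP lr : last s r == t by case: P.
(* The two outer pieces r1 and r2 each span at most half of [s, t]. *)
have [|r1 [a [r2 [rE l1 l2]]]] := @split_partition_at s r ((s + t) / 2) r0.
  by rewrite lr; lra.
case: P; rewrite rE cat_path/= => /and3P[p1 pa p2] /eqP.
rewrite last_cat/= => la.
have P1 : itv_partition s (last s r1) r1 by split.
have P2 : itv_partition a t r2 by split=> //; apply/eqP.
set p := last s r1 in l1 pa P1.
have sp := itv_partition_le P1; have at_ := itv_partition_le P2.
have sz : (size r1 < n)%N /\ (size r2 < n)%N.
  by move: rn; rewrite rE size_cat/= addnS ltnS => h; split;
    apply: leq_ltn_trans h; rewrite ?leq_addr ?leq_addl.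
have half (x y : R) : x <= y -> y - x <= (t - s) / 2 ->
    (y - x) `^ theta <= (t - s) `^ theta * 2^-1 `^ theta.
  move=> xy xh; rewrite -powRM ?subr_ge0//.
  by apply: ge0_ler_powR; rewrite ?nnegrE; lra.
have pt : p <= t by lra.
have la' : lo <= a by lra.
have lp : lo <= p by lra.
have cK := mulr_ge0 c_ge0 K_ge0.
have E1 : `|rsum A s r1 - A s p| <= c * K * ((t - s) `^ theta * 2^-1 `^ theta).
  apply: le_trans (IH r1 sz.1 s p ls (le_trans pt th) P1) _.
  by apply: ler_wpM2l => //; apply: half => //; lra.
have E2 : `|rsum A a r2 - A a t| <= c * K * ((t - s) `^ theta * 2^-1 `^ theta).
  apply: le_trans (IH r2 sz.2 a t la' th P2) _.
  by apply: ler_wpM2l => //; apply: half => //; lra.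
have D1 := defectW s p t ls sp pt th.
have D2 : `|A p t - A p a - A a t| <= K * (t - s) `^ theta.
  apply: le_trans (defectW p a t lp (ltW pa) at_ th) _.
  by apply: ler_wpM2l => //; apply: ge0_ler_powR; rewrite ?nnegrE; lra.
rewrite rsum_cat/= -/p.
set x := (t - s) `^ theta in E1 E2 D1 D2 *.
set q := 2^-1 `^ theta in E1 E2.
(* The recursion solved by the constant, with q = (1/2)^theta. *)
have -> : c * K * x = c * K * (x * q) + c * K * (x * q) + K * x + K * x.
  have q1 := half_powR_lt t1; rewrite -/q in q1.
  have q1' : 1 - 2 * q != 0 by rewrite gt_eqF.
  rewrite /c /sewing_const -/q; field. exact: q1'.
move: E1 E2 D1 D2; rewrite !ler_norml => /andP[? ?] /andP[? ?] /andP[? ?] /andP[? ?].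
by apply/andP; split; lra.
Qed.

Section Estimate.
Variables (A : R -> R -> R) (lo hi theta K : R).
Hypotheses (theta_gt1 : 1 < theta) (K_ge0 : 0 <= K).
Hypothesis defect : forall s u t, lo <= s -> s < u -> u < t -> t <= hi ->
  `|A s t - A s u - A u t| <= K * (t - s) `^ theta.

Let c := sewing_const theta.

Let cK_ge0 : 0 <= c * K.
Proof. by rewrite mulr_ge0// divr_ge0// ltW// half_powR_lt. Qed.

(** The points of a partition being distinct, its Riemann sums do not see the values
    of A on the diagonal, which may therefore be reset to 0. *)
Lemma sewing_maximal r s t : lo <= s -> t <= hi -> s < t ->
  itv_partition s t r -> `|rsum A s r - A s t| <= c * K * (t - s) `^ theta.
Proof.
move=> ls th st P.
pose B x y := if x == y then 0 else A x y.
have BE x y : x < y -> B x y = A x y by move=> xy; rewrite /B lt_eqF.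
have rsumE : forall r' x, path <%R x r' -> rsum B x r' = rsum A x r'.
  by elim=> //= a r' IH x /andP[xa pr]; rewrite BE// IH.
rewrite -rsumE; last by case: P.
rewrite -BE//; apply: (@sewing_maximal_diag0 B lo hi) => //.
- by move=> x; rewrite /B eqxx.
- by move=> x y z lx xy yz zh; rewrite (BE x y)// (BE y z)// (BE x z) ?(lt_trans xy)//; exact: defect.
Qed.

(** Small mesh as a property of consecutive points passes to tails and to
    concatenations by the standard lemmas on paths. *)
Definition fine_partition (delta s t : R) r :=
  path (fun x y => x < y < x + delta) s r && (last s r == t).

Lemma fine_itv_partition delta s t r : fine_partition delta s t r ->
  itv_partition s t r.
Proof.
by case/andP=> p l; split=> //; apply: sub_path p => x y /andP[].
Qed.

(** The refinement keeps the blocks of Q between consecutive points of P, along which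
    the sums over Q split. *)
Fixpoint refines (s : R) P Q : Prop :=
  if P is a :: P' then
    exists Q1 Q2, [/\ Q = Q1 ++ Q2, itv_partition s a Q1 & refines a P' Q2]
  else Q = [::].

(** The smaller of the two heads is the first point of the refinement; the list that
    did not contain it is still a partition of the remaining interval. *)
Lemma common_refinement s t P Q : itv_partition s t P -> itv_partition s t Q ->
  exists S, [/\ itv_partition s t S, refines s P S & refines s Q S].
Proof.
have refines_self r x y : itv_partition x y r -> refines x r r.
  elim: r x => //= a r IH x pr; exists [:: a], r; split=> //.
    by apply: itv_partition1; case: pr => /andP[].
  by apply: IH; exact: itv_partition_cons pr.
(* Prepending to S a point a of P that precedes the head of Q. *)
have step a b x P' Q' S : x < a -> refines a P' S -> refines a (b :: Q') S ->
    refines x (a :: P') (a :: S) /\ refines x (b :: Q') (a :: S).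
  move=> xa rP [Q1 [Q2 [SE ab rQ]]]; split.
    by exists [:: a], S; split=> //; exact: itv_partition1.
  exists (a :: Q1), Q2; rewrite SE; split=> //.
  by rewrite -cat1s; apply: itv_partition_cat ab; exact: itv_partition1.
have [n] := ubnP (size P + size Q)%N.
elim: n s P Q => // n IH s [|a P] [|b Q] /= sz pP pQ.
- by exists [::].
- by move: pQ; rewrite -(itv_partition_nil pP) => /itv_partitionxx.
- by move: pP; rewrite -(itv_partition_nil pQ) => /itv_partitionxx.
have sa : s < a by case: pP => /andP[].
have sb : s < b by case: pQ => /andP[].
have pP' := itv_partition_cons pP; have pQ' := itv_partition_cons pQ.
have cons_part x y S : x < y -> itv_partition y t S -> itv_partition x t (y :: S).
  by move=> xy pS; rewrite -cat1s; apply: itv_partition_cat pS; exact: itv_partition1.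
rewrite addSn addnS ltnS in sz.
case: (ltgtP a b) => ab.
- have pQa : itv_partition a t (b :: Q) by exact: cons_part.
  have [|S [pS r1 r2]] := IH a P (b :: Q) _ pP' pQa.
    by rewrite /= addnS.
  have [rP rQ] := step _ _ _ _ _ _ sa r1 r2.
  by exists (a :: S); split=> //; exact: cons_part.
- have pPb : itv_partition b t (a :: P) by exact: cons_part.
  have [|S [pS r1 r2]] := IH b (a :: P) Q _ pPb pQ'.
    by rewrite /= addSn.
  have [rQ rP] := step _ _ _ _ _ _ sb r2 r1.
  by exists (b :: S); split=> //; exact: cons_part.
- move: pQ'; rewrite -ab => pQ'.
  have [|S [pS r1 r2]] := IH a P Q _ pP' pQ'; first exact: ltnW.
  exists (a :: S); split; first exact: cons_part.
    by exists [:: a], S; split=> //; exact: itv_partition1.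
  by exists [:: a], S; split=> //; exact: itv_partition1.
Qed.

(** A block of length l contributes l^theta <= delta^(theta - 1) l, and the lengths
    add up to t - s. *)
Lemma rsum_refines delta s t P Q : lo <= s -> t <= hi ->
  fine_partition delta s t P -> refines s P Q ->
  `|rsum A s Q - rsum A s P| <= c * K * delta `^ (theta - 1) * (t - s).
Proof.
move=> + th; have t1 := theta_gt1; elim: P s Q => /= [|a P IH] s Q ls.
  by move=> /andP[_ /eqP/= <-] ->/=; rewrite !subrr normr0 mulr0.
move=> /andP[/= /andP[/andP[sa ad] pP] lP] [Q1 [Q2 [-> pQ1 rQ]]].
have fP : fine_partition delta a t P by apply/andP.
have at_ := itv_partition_le (fine_itv_partition fP).
have := IH a Q2 (le_trans ls (ltW sa)) fP rQ.
have := sewing_maximal ls (le_trans at_ th) sa pQ1.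
have : c * K * (a - s) `^ theta <= c * K * delta `^ (theta - 1) * (a - s).
  rewrite -[leRHS]mulrA; apply: ler_wpM2l => //.
  rewrite -mulr_powRB1; [|lra|lra].
  rewrite mulrC; apply: ler_wpM2r; first lra.
  by apply: ge0_ler_powR; rewrite ?nnegrE; lra.
rewrite rsum_cat (_ : last s Q1 = a); last by case: pQ1 => _ /eqP.
move=> h1 h2 h3.
rewrite (_ : _ - _ = (rsum A s Q1 - A s a) + (rsum A a Q2 - rsum A a P)); last ring.
apply: le_trans (ler_normD _ _) _.
rewrite (_ : _ * (t - s) = c * K * delta `^ (theta - 1) * (a - s) + c * K * delta `^ (theta - 1) * (t - a)); last ring.
by apply: lerD => //; exact: le_trans h1.
Qed.

Lemma rsum_fine delta s t P Q : lo <= s -> t <= hi ->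
  fine_partition delta s t P -> fine_partition delta s t Q ->
  `|rsum A s P - rsum A s Q| <= 2 * (c * K * delta `^ (theta - 1) * (t - s)).
Proof.
move=> ls th fP fQ.
have [S [pS rP rQ]] := common_refinement (fine_itv_partition fP) (fine_itv_partition fQ).
have := rsum_refines ls th fP rP; have := rsum_refines ls th fQ rQ.
set X := c * K * _ * _.
by rewrite !ler_norml => /andP[? ?] /andP[? ?]; apply/andP; split; lra.
Qed.

End Estimate.
End Sewing.

(** * The sewing lemma *)
Section MeshFilter.
Variable R : realType.
Implicit Types (A B : R -> R -> R) (r : seq R).

Lemma mesh_cons (s a : R) r : mesh s (a :: r) = Num.max (a - s) (mesh a r).
Proof.
rewrite /mesh big_nat_recl//=; congr Num.max.
apply: eq_big_nat => p /andP[_ pr]; rewrite /pt /=.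
congr (_ - _); first exact: set_nth_default.
by case: p pr => //= p pr; apply: set_nth_default; exact: ltnW.
Qed.

Lemma fine_partitionE (delta s t : R) r : 0 < delta ->
  fine_partition delta s t r <-> itv_partition s t r /\ mesh s r < delta.
Proof.
move=> d0; rewrite /fine_partition.
elim: r s => [|a r IH] s.
  by rewrite /mesh big_nil/=; split=> [h|[[_]]//]; split.
rewrite mesh_cons gt_max /= -andbA; split.
  move=> /andP[/andP[sa ad] /IH[pr mr]]; rewrite mr; split; last by lra.
  by case: pr => pr lr; split=> //=; rewrite sa.
move=> [pr /andP[as_ mr]]; have /IH -> : itv_partition a t r /\ mesh a r < delta.
  by split=> //; exact: itv_partition_cons pr.
by case: pr => /andP[sa _ _]; rewrite sa andbT; lra.
Qed.

Lemma mesh_to0E (s t : R) :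
  mesh_to0 s t = filter_from [set d : R | 0 < d] (fun d => fine_partition d s t).
Proof.
apply/seteqP; split=> P [d d0 dP]; exists d => // r rP; apply: dP => /=;
  by apply/fine_partitionE.
Qed.

(** Steps of length delta / 2 until the remaining length is below delta. *)
Lemma fine_partition_exists (delta s t : R) : 0 < delta -> s <= t ->
  exists r, fine_partition delta s t r.
Proof.
move=> d0; rewrite le_eqVlt => /predU1P[->|st].
  by exists [::]; rewrite /fine_partition /= eqxx.
have [n] : exists n : nat, t - s < n%:R * (delta / 2).
  exists (Num.truncn ((t - s) / (delta / 2))).+1.
  by rewrite -ltr_pdivrMr ?truncnS_gt// divr_gt0.
elim: n s st => [|n IH] s st; first by rewrite mul0r; lra.
have [small _|big] := ltP (t - s) delta.
  by exists [:: t]; rewrite /fine_partition /= eqxx !andbT st; lra.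
rewrite -natr1 mulrDl mul1r => h.
have [||r /andP[pr lr]] := IH (s + delta / 2); [lra|lra|].
exists (s + delta / 2 :: r); rewrite /fine_partition /= pr lr !andbT.
by apply/andP; split; lra.
Qed.

Global Instance mesh_to0_filter (s t : R) : Filter (mesh_to0 s t).
Proof.
apply: filter_from_filter; first by exists 1 => /=.
move=> d1 d2 /= d10 d20; exists (Num.min d1 d2); first by rewrite /= lt_min d10.
by move=> r [pr]; rewrite lt_min => /andP[].
Qed.

Lemma mesh_to0_proper (s t : R) : s <= t -> ProperFilter (mesh_to0 s t).
Proof.
move=> st; rewrite mesh_to0E; apply: Build_ProperFilter; last first.
  by rewrite -mesh_to0E; exact: mesh_to0_filter.
by move=> [d /= d0] h; have [r /h] := fine_partition_exists d0 st.
Qed.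

Lemma near_mesh_to0 (s t delta : R) : 0 < delta ->
  \forall r \near mesh_to0 s t, fine_partition delta s t r.
Proof. by move=> d0; rewrite mesh_to0E; exists delta. Qed.

Definition sewing A s t : R := lim (rsum A s @ mesh_to0 s t).

Definition sewable A s t := cvg (rsum A s @ mesh_to0 s t).

(** A bound on Riemann sums passes to the limits. With B = 0 it estimates a single
    limit, with K = 0 it identifies the difference of two limits. *)
Lemma sewing_close A B s t x K : s <= t -> sewable A s t -> sewable B s t ->
  (forall r, itv_partition s t r -> `|rsum A s r - rsum B s r - x| <= K) ->
  `|sewing A s t - sewing B s t - x| <= K.
Proof.
move=> st cA cB h; have pF := mesh_to0_proper st.
have c : `|rsum A s r - rsum B s r - x| @[r --> mesh_to0 s t] -->
    `|sewing A s t - sewing B s t - x|.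
  by apply: cvg_norm; apply: cvgB; [exact: cvgB|exact: cvg_cst].
rewrite -(cvg_lim (@Rhausdorff R) c); apply: limr_le; first by apply/cvg_ex; exists (`|sewing A s t - sewing B s t - x|).
near=> r; apply: h; have : fine_partition 1 s t r by near: r; exact: near_mesh_to0.
exact: fine_itv_partition.
Unshelve. all: by end_near.
Qed.

Lemma sewing_ss A s : sewing A s s = 0.
Proof.
have pF := mesh_to0_proper (lexx s).
apply: (@cvg_lim _ (@Rhausdorff R)).
apply: cvg_near_cst; near=> r.
have /fine_itv_partition/itv_partitionxx -> : fine_partition 1 s s r.
  by near: r; exact: near_mesh_to0.
by [].
Unshelve. all: by end_near.
Qed.

Lemma sewing_cst0 s t : s <= t ->
  sewable (fun _ _ => 0) s t /\ sewing (fun _ _ => 0) s t = 0.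
Proof.
move=> st; have pF := mesh_to0_proper st.
have c : rsum (fun _ _ => 0) s r @[r --> mesh_to0 s t] --> (0 : R).
  rewrite (_ : rsum _ s = (fun=> 0)); first exact: cvg_cst.
  by apply/funext => r; elim: r s {st pF} => //= x r IH s; rewrite IH addr0.
by split; [apply/cvg_ex; exists 0|exact: (cvg_lim (@Rhausdorff R) c)].
Qed.

(** Fine partitions of [s, u] and of [u, t] concatenate to a fine partition of
    [s, t]. *)
Lemma sewing_additive A s u t : s <= u -> u <= t ->
  sewable A s u -> sewable A u t -> sewable A s t ->
  sewing A s t = sewing A s u + sewing A u t.
Proof.
move=> su ut c1 c2 c3; apply/eqP; rewrite -subr_eq0 -normr_le0.
apply/ler_addgt0Pr => /= eps e0; rewrite add0r.
have near_lim x y : sewable A x y -> exists2 d, 0 < d &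
    forall r, fine_partition d x y r -> `|sewing A x y - rsum A x r| < eps / 3.
  have e3 : 0 < eps / 3 by rewrite divr_gt0.
  move=> /cvgrPdist_lt/(_ _ e3) [d d0 dP].
  by exists d => // r /(fine_partitionE _ _ _ d0); exact: dP.
have [d1 d10 h1] := near_lim _ _ c1.
have [d2 d20 h2] := near_lim _ _ c2.
have [d3 d30 h3] := near_lim _ _ c3.
pose d := Num.min (Num.min d1 d2) d3.
have d0 : 0 < d by rewrite !lt_min d10 d20.
have weaken d' x y r : d <= d' -> fine_partition d x y r -> fine_partition d' x y r.
  move=> dd /andP[pr lr]; rewrite /fine_partition lr andbT.
  apply: sub_path pr => z w /andP[-> /= zw].
  by apply: (lt_le_trans zw); rewrite lerD2l.
have [r1 f1] := fine_partition_exists d0 su.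
have [r2 f2] := fine_partition_exists d0 ut.
have f12 : fine_partition d s t (r1 ++ r2).
  case/andP: f1 => p1 /eqP l1; case/andP: f2 => p2 l2.
  by rewrite /fine_partition cat_path last_cat l1 p1 p2.
have := h3 (r1 ++ r2) (weaken _ _ _ _ _ f12).
have := h2 r2 (weaken _ _ _ _ _ f2).
have := h1 r1 (weaken _ _ _ _ _ f1).
rewrite rsum_cat; case/andP: (f1) => _ /eqP ->.
rewrite !ge_min !lexx !orbT => /(_ isT) + /(_ isT) + /(_ isT).
by rewrite !ltr_norml ler_norml => /andP[? ?] /andP[? ?] /andP[? ?]; apply/andP; split; lra.
Qed.

End MeshFilter.

(** Riemann sums over two fine partitions are compared through a common
    refinement, so that they form a Cauchy family as the mesh tends to 0. *)
Section SewingLemma.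
Variables (R : realType) (A : R -> R -> R) (lo hi theta K : R).
Hypotheses (theta_gt1 : 1 < theta) (K_ge0 : 0 <= K).
Hypothesis defect : forall s u t, lo <= s -> s < u -> u < t -> t <= hi ->
  `|A s t - A s u - A u t| <= K * (t - s) `^ theta.

Lemma sewing_cvg s t : lo <= s -> s <= t -> t <= hi -> sewable A s t.
Proof.
move=> ls st th; have pF := mesh_to0_proper st.
apply/cauchy_cvgP/cauchy_exP => eps e0.
have [d d0 dP] : exists2 d, 0 < d &
    2 * (sewing_const theta * K * d `^ (theta - 1) * (t - s)) < eps.
  have t1 : 0 < theta - 1 by rewrite subr_gt0.
  set c := sewing_const theta * K.
  have c0 : 0 <= c by rewrite mulr_ge0// divr_ge0// ltW// half_powR_lt.
  have c1 : 0 < 2 * (c * (t - s)) + 1.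
    by rewrite ltr_wpDl//; apply: mulr_ge0 => //; apply: mulr_ge0 => //; rewrite subr_ge0.
  have q0 : 0 < eps / (2 * (c * (t - s)) + 1) by rewrite divr_gt0.
  exists ((eps / (2 * (c * (t - s)) + 1)) `^ (theta - 1)^-1); first exact: powR_gt0.
  rewrite -powRrM mulVf ?gt_eqF// powRr1 ?(ltW q0)//.
  rewrite (_ : 2 * _ = eps * (2 * (c * (t - s)) / (2 * (c * (t - s)) + 1))).
    by rewrite -[ltRHS]mulr1 ltr_pM2l// ltr_pdivrMr// mul1r ltrDl.
  by rewrite /=; field; rewrite gt_eqF.
have [P fP] := fine_partition_exists d0 st.
exists (rsum A s P); apply: filterS (near_mesh_to0 s t d0) => r fr /=.
rewrite -ball_normE /=.
exact: le_lt_trans (rsum_fine theta_gt1 K_ge0 defect ls th fP fr) dP.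
Qed.

End SewingLemma.

(** * Partial derivatives *)
Section LinesAndPartials.
Variables (R : realType) (e : nat).
Local Notation V := 'rV[R]_e.
Local Notation ev l := (delta_mx 0 l : V).
Implicit Types (f g : V -> R) (x : V).

Lemma is_derive_line f x v t : derivable f (x + t *: v) v ->
  is_derive t (1 : R) (fun u : R => f (x + u *: v)) ('D_v f (x + t *: v)).
Proof.
have E : (fun h : R => h^-1 *: (((fun u : R => f (x + u *: v)) \o shift t) (h *: 1) - f (x + t *: v))) =
    (fun h : R => h^-1 *: ((f \o shift (x + t *: v)) (h *: v) - f (x + t *: v))).
  apply/funext => h /=; congr (_ *: (f _ - _)).
  have -> : h *: (1 : R) = h by rewrite /GRing.scale/= mulr1.
  by rewrite scalerDl addrCA.
by move=> df; split; rewrite /derivable /derive E.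
Qed.

Lemma is_derive_coord f x l c t : (forall y, derivable f y (ev l)) ->
  is_derive t (1 : R) (fun u : R => f (x + (u * c) *: ev l))
    (c * partial l f (x + (t * c) *: ev l)).
Proof.
move=> df; have d1 := @is_derive_line f x (ev l) (t * c) (df _).
have d2 : is_derive t (1 : R) (fun u : R => u * c) c.
  by apply: is_derive_eq; rewrite /= ?scaler0 ?add0r ?addr0 /GRing.scale /= ?mulr1.
by rewrite mulrC; exact: (@is_derive1_comp _ _ (fun u : R => u * c) t _ _ d1 d2).
Qed.

Lemma is_derive_bigsum (I : Type) (s : seq I) (P : pred I) (F : I -> R -> R)
    (dF : I -> R) (t : R) : (forall i, P i -> is_derive t (1 : R) (F i) (dF i)) ->
  is_derive t (1 : R) (fun u : R => \sum_(i <- s | P i) F i u) (\sum_(i <- s | P i) dF i).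
Proof.
move=> d; elim: s => [|i s IH].
  rewrite big_nil (_ : (fun u => _) = cst 0); first exact: is_derive_cst.
  by apply/funext => u; rewrite big_nil.
rewrite big_cons (_ : (fun u => _) =
    if P i then F i \+ (fun u => \sum_(j <- s | P j) F j u)
    else (fun u => \sum_(j <- s | P j) F j u)).
  by case: ifP => // Pi; have := d _ Pi => di; exact: is_deriveD.
by apply/funext => u; rewrite big_cons; case: ifP.
Qed.

Lemma mvt_bound (phi dphi : R -> R) (B : R) :
  (forall t, is_derive t (1 : R) phi (dphi t)) ->
  (forall t, 0 <= t -> t <= 1 -> `|dphi t| <= B) -> `|phi 1 - phi 0| <= B.
Proof.
move=> d b; have pc : {within `[0, 1], continuous phi}.
  by apply: derivable_within_continuous => x _; exact: ex_derive.
have [c] := MVT ltr01 (fun t _ => d t) pc.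
by rewrite in_itv/= => /andP[c0 c1] ->; rewrite subr0 mulr1 b// ltW.
Qed.


Lemma classC_continuous k f : classC k f -> continuous f.
Proof. by case: k => [|k] // []. Qed.

Lemma classC_derivable k f l : classC k.+1 f -> forall x, derivable f x (ev l).
Proof. by case=> _ /(_ l)[]. Qed.

Lemma classC_partial k f l : classC k.+1 f -> classC k (partial l f).
Proof. by case=> _ /(_ l)[]. Qed.

Lemma classCW k f : classC k.+1 f -> classC k f.
Proof.
elim: k f => [|k IH] f [cf df] //; split=> // l.
by case: (df l) => dl /IH.
Qed.

Lemma classC_le k k' f : (k <= k')%N -> classC k' f -> classC k f.
Proof. by move=> /subnK <-; elim: (k' - k)%N => // m IH /classCW. Qed.

(** Applying the mean value theorem in one direction to the increment in the
    other direction turns a second difference into a mixed derivative. *)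
Lemma second_difference g l k x (h : R) : classC 2 g -> 0 < h ->
  exists t u, [/\ 0 <= t <= h, 0 <= u <= h &
    g (x + h *: ev l + h *: ev k) - g (x + h *: ev l) - (g (x + h *: ev k) - g x)
    = h ^+ 2 * partial k (partial l g) (x + t *: ev l + u *: ev k)].
Proof.
move=> gC h0.
have dg : forall y, derivable g y (ev l) by exact: classC_derivable gC.
have dlg : forall y, derivable (partial l g) y (ev k).
  by move=> y; apply: (@classC_derivable 0); exact: classC_partial.
have line_cont (phi dphi : R -> R) : (forall t : R, is_derive t (1 : R) phi (dphi t)) ->
    exists2 t, 0 <= t <= h & phi h - phi 0 = h * dphi t.
  move=> d; have pc : {within `[0, h], continuous phi}.
    by apply: derivable_within_continuous => y _; exact: ex_derive.
  have [c] := MVT h0 (fun y _ => d y) pc.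
  rewrite in_itv/= => /andP[c0 c1] E; exists c; first by rewrite !ltW.
  by rewrite E subr0 mulrC.
pose phi (t : R) := g (x + h *: ev k + t *: ev l) - g (x + t *: ev l).
have [t th tE] := line_cont phi (fun t =>
    partial l g (x + h *: ev k + t *: ev l) - partial l g (x + t *: ev l))
  (fun t => is_deriveB (is_derive_line (dg _)) (is_derive_line (dg _))).
have [u uh uE] := line_cont (fun u => partial l g (x + t *: ev l + u *: ev k))
  (fun u => partial k (partial l g) (x + t *: ev l + u *: ev k))
  (fun u => is_derive_line (dlg _)).
exists t, u; split=> //.
rewrite expr2 -mulrA -uE !scale0r !addr0.
move: tE; rewrite /phi !scale0r !addr0 => tE.
rewrite (addrAC x (t *: ev l)) -tE (addrAC x (h *: ev l)); ring.
Qed.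

(** The second difference is symmetric in the two directions, so that the two mixed
    derivatives agree at a pair of points which tend to x with the step h. *)
Lemma partialC g l k : classC 2 g ->
  partial k (partial l g) = partial l (partial k g).
Proof.
move=> gC; apply/funext => x; apply/eqP; rewrite -subr_eq0 -normr_le0.
apply/ler_addgt0Pr => /= eps e0; rewrite add0r.
have close (p q r r' : R) : r = r' -> `|p - r| < eps / 2 -> `|q - r'| < eps / 2 ->
    `|p - q| <= eps.
  move=> ->; rewrite !ltr_norml ler_norml => /andP[? ?] /andP[? ?].
  by apply/andP; split; lra.
have cont a b : {for x, continuous (partial a (partial b g))}.
  by apply: (@classC_continuous 0); do 2!apply: classC_partial.
have e2 : 0 < eps / 2 by rewrite divr_gt0.
have near_x a b : exists2 h : R, 0 < h & forall t u : R, 0 <= t <= h -> 0 <= u <= h ->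
    `|partial a (partial b g) x - partial a (partial b g) (x + t *: ev b + u *: ev a)|
      < eps / 2.
  have /cvgrPdist_lt/(_ _ e2)/nbhs_ballP[d /= d0 dP] := cont a b.
  exists (d / 3); first by rewrite divr_gt0.
  move=> t u /andP[t0 th] /andP[u0 uh]; apply: dP; split=> // i j.
  rewrite -ball_normE /= !mxE.
  by case: (_ && _); case: (_ && _); rewrite /= ?mulr0n ?mulr1n ?mulr0 ?mulr1
    ltr_norml; apply/andP; split; lra.
have [h1 h10 H1] := near_x k l; have [h2 h20 H2] := near_x l k.
have [h [h0 hh1 hh2]] : exists h : R, [/\ 0 < h, h <= h1 & h <= h2].
  by exists (Num.min h1 h2); rewrite lt_min h10 h20 !ge_min !lexx orbT.
have [t [u [/andP[t0 th] /andP[u0 uh] E1]]] := second_difference l k x gC h0.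
have [t' [u' [/andP[t0' th'] /andP[u0' uh'] E2]]] := second_difference k l x gC h0.
have E : partial k (partial l g) (x + t *: ev l + u *: ev k) =
         partial l (partial k g) (x + t' *: ev k + u' *: ev l).
  have hh : h ^+ 2 != 0 by rewrite expf_neq0// gt_eqF.
  apply: (mulfI hh); apply: (etrans (esym E1)); apply: etrans E2.
  rewrite (addrAC x (h *: ev l)).
  by move: (g _) (g _) (g _) (g _) => A B C D; ring.
apply: (close _ _ _ _ E).
  by apply: H1; rewrite ?t0 ?u0 (le_trans _ hh1).
by apply: H2; rewrite ?t0' ?u0' (le_trans _ hh2).
Qed.

(** Words of directions, as opposed to multi-indices, allow one more derivative to
    be put in front and then moved to its place in the fixed order of
    differentiation. *)
Definition pder (s : seq 'I_e) f : V -> R := foldr (@partial R e) f s.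

Lemma pder_classC s k f : classC (size s + k) f -> classC k (pder s f).
Proof.
elim: s k => [|l s IH] k // fC; apply: classC_partial; apply: IH.
by rewrite addnS.
Qed.

Lemma pder_perm s s' f : perm_eq s s' -> classC (size s) f -> pder s f = pder s' f.
Proof.
have move_head l s1 s2 : classC (size (l :: s1 ++ s2)) f ->
    pder (l :: s1 ++ s2) f = pder (s1 ++ l :: s2) f.
  elim: s1 => [//|k s1 IH] /= fC.
  rewrite partialC; first by congr (partial k _); apply: IH; exact: classCW.
  by apply: pder_classC; rewrite addn2.
elim: s s' => [|l s IH] s' ss' fC.
  by move: ss'; rewrite perm_sym => /perm_nilP ->.
have ls' : l \in s' by rewrite -(perm_mem ss') mem_head.
case/splitPr: ls' ss' => s1 s2; rewrite perm_sym perm_catC /= perm_cons => ss'.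
rewrite -move_head; last first.
  apply: classC_le fC; rewrite /= ltnS size_cat addnC -size_cat.
  by rewrite (perm_size ss').
congr (partial l _); apply: IH; last exact: classCW.
by rewrite perm_sym; apply: perm_trans ss'; rewrite perm_catC.
Qed.

End LinesAndPartials.

(** * Multi-indices *)
Section MultiIndices.
Variable e : nat.
Implicit Types i p q : mindex e.

Definition mone (l : 'I_e) : mindex e := [ffun k => (k == l) : nat].

Definition mleb p i := [forall l, (p l <= i l)%N].

Lemma mlebP p i : reflect (mle p i) (mleb p i).
Proof. exact: forallP. Qed.

Lemma maddE p q l : (p + q) l = (p l + q l)%N.
Proof. by rewrite ffunE. Qed.

Lemma mdegD p q : mdeg (p + q) = (mdeg p + mdeg q)%N.
Proof. by rewrite /mdeg -big_split; apply: eq_bigr => l _; rewrite ffunE. Qed.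

Lemma mdeg_mone l : mdeg (mone l) = 1%N.
Proof.
rewrite /mdeg (bigD1 l)//= ffunE eqxx big1// => k kl.
by rewrite ffunE (negbTE kl).
Qed.

Lemma mdeg0 : mdeg (0 : mindex e) = 0%N.
Proof. by rewrite /mdeg big1// => l _; rewrite ffunE. Qed.

Lemma maddKC p i : msub (p + i) p = i.
Proof. by apply/ffunP => l; rewrite ffunE maddE addKn. Qed.

Lemma msubKC p i : mle p i -> p + msub i p = i.
Proof. by move=> pi; apply/ffunP => l; rewrite maddE ffunE subnKC. Qed.

Lemma mle_addr p i : mle p (p + i).
Proof. by move=> l; rewrite maddE leq_addr. Qed.

Lemma mdeg_mle p i : mle p i -> (mdeg p <= mdeg i)%N.
Proof. by move=> pi; rewrite /mdeg; apply: leq_sum => l _. Qed.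

(** Sums over this list, restricted by boolean conditions, can be exchanged and
    reindexed as ordinary iterated sums. *)
Definition mlow N : seq (mindex e) := fset_set [set i : mindex e | (mdeg i < N)%N].

Lemma finite_mdeg_lt N : finite_set [set i : mindex e | (mdeg i < N)%N].
Proof.
apply: (sub_finite_set _ (finite_mbounded e N)) => i /= iN l.
exact: leq_trans (leq_mdeg i l) (ltnW iN).
Qed.

Lemma mem_mlow N i : (i \in mlow N) = (mdeg i < N)%N.
Proof.
rewrite /mlow in_fset_set; last exact: finite_mdeg_lt.
by apply/idP/idP; rewrite ?inE.
Qed.

Lemma mlow_uniq N : uniq (mlow N). Proof. exact: fset_uniq. Qed.

Lemma sum_mlow_fsbig (W : nmodType) N (A : set (mindex e)) (P : pred (mindex e)) (F : mindex e -> W) :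
  (forall i, A i <-> (i \in mlow N) && P i) ->
  \sum_(i \in A) F i = \sum_(i <- mlow N | P i) F i.
Proof.
move=> AP.
have finA : finite_set A.
  by apply: (sub_finite_set _ (finite_mdeg_lt N)) => i /AP/andP[]; rewrite mem_mlow.
rewrite fsbig_finite//= -[RHS]big_filter; apply: perm_big.
apply: uniq_perm; rewrite ?fset_uniq ?filter_uniq ?mlow_uniq//.
move=> i; rewrite mem_filter in_fset_set// andbC.
by apply/idP/idP; rewrite inE => /AP.
Qed.

Lemma sum_mlow_shift (W : nmodType) N p (P : pred (mindex e)) (F : mindex e -> W) :
  (forall i, P i -> mle p i -> (mdeg i < N)%N) ->
  \sum_(i <- mlow N | mleb p i && P i) F i = \sum_(i <- mlow N | P (p + i)) F (p + i).
Proof.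
move=> PN; rewrite -[LHS]big_filter -[RHS]big_filter -[RHS](big_map (fun i => p + i) xpredT F).
apply: perm_big; apply: uniq_perm.
- by rewrite filter_uniq ?mlow_uniq.
- rewrite map_inj_uniq ?filter_uniq ?mlow_uniq//; exact: (can_inj (g := fun i => msub i p) (maddKC p)).
move=> i; rewrite mem_filter; apply/idP/mapP.
  move=> /andP[/andP[/mlebP pi Pi] iN]; exists (msub i p); rewrite ?msubKC//.
  rewrite mem_filter msubKC// Pi mem_mlow; move: iN; rewrite mem_mlow.
  by apply: leq_ltn_trans; rewrite -{2}(msubKC pi) mdegD leq_addl.
move=> [j]; rewrite mem_filter => /andP[Pj jN] ->.
have pj := mle_addr p j.
by rewrite Pj mem_mlow (PN _ Pj pj) !andbT; apply/mlebP.
Qed.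

End MultiIndices.

(** A pair q <= k is a pair (q, q + i). Applied to Chen's relation, this collects the
    terms that multiply a given component on the later interval. *)
Lemma sum_chain (R : nmodType) e N m (F : mindex e -> mindex e -> R) : (m <= N)%N ->
  \sum_(k <- mlow e N | (mdeg k < m)%N) \sum_(q <- mlow e N | mleb q k) F q (msub k q) =
  \sum_(q <- mlow e N | (mdeg q < m)%N)
    \sum_(i <- mlow e N | (mdeg q + mdeg i < m)%N) F q i.
Proof.
move=> mN.
rewrite (exchange_big_dep (fun q => (mdeg q < m)%N)) /=; last first.
  by move=> k q km /mlebP/mdeg_mle qk; exact: leq_ltn_trans km.
apply: eq_bigr => q _.
rewrite (eq_bigl (fun k => mleb q k && (mdeg k < m)%N)); last by move=> k; rewrite andbC.
rewrite (@sum_mlow_shift _ _ _ q (fun k => (mdeg k < m)%N) (fun k => F q (msub k q))).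
  by apply: eq_big => [i|i _]; rewrite ?mdegD ?maddKC.
by move=> k km _; exact: leq_trans mN.
Qed.

Lemma sum_pairs_fsbig (W : nmodType) e N (A : set (mindex e * mindex e)) m
    (F : mindex e -> mindex e -> W) : (m <= N)%N ->
  (forall j k, A (j, k) <-> (mdeg j + mdeg k < m)%N) ->
  \sum_(jk \in A) F jk.1 jk.2 =
  \sum_(j <- mlow e N | (mdeg j < m)%N) \sum_(k <- mlow e N | (mdeg j + mdeg k < m)%N) F j k.
Proof.
move=> mN AE.
have small j k : A (j, k) -> (j \in mlow e N) && (k \in mlow e N).
  by move=> /AE jk; rewrite !mem_mlow; apply/andP; split; lia.
have finA : finite_set A.
  apply: (sub_finite_set _ (finite_setX (@finite_mdeg_lt e N) (@finite_mdeg_lt e N))).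
  by move=> [j k] /small; rewrite !mem_mlow => /andP[].
rewrite fsbig_finite//=.
transitivity (\sum_(jk <- [seq (j, k) | j <- mlow e N, k <- mlow e N] |
    (mdeg jk.1 + mdeg jk.2 < m)%N) F jk.1 jk.2).
  rewrite -[RHS]big_filter; apply: perm_big; apply: uniq_perm.
  - exact: fset_uniq.
  - by rewrite filter_uniq// allpairs_uniq ?mlow_uniq// => -[? ?] [? ?].
  move=> [j k]; rewrite mem_filter in_fset_set//=; apply/idP/andP => [|[jk _]].
    rewrite inE => jk; split; first exact/AE.
    by have /andP[jN kN] := small _ _ jk; exact: allpairs_f.
  by rewrite inE; exact/AE.
rewrite big_mkcond big_allpairs [RHS]big_mkcond /=; apply: eq_bigr => j _.
case: ifPn => [jm|jm]; first by rewrite -big_mkcond.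
rewrite big1// => k _; case: ifPn => // jk; case/negP: jm.
by apply: leq_ltn_trans jk; exact: leq_addr.
Qed.

(** * Derivatives and monomials of a given multi-index *)
Section MultiDerivatives.
Variables (R : realType) (e : nat).
Local Notation V := 'rV[R]_e.
Local Notation ev l := (delta_mx 0 l : V).
Implicit Types (f g : V -> R) (x h : V) (i p q : mindex e).

Definition mword p : seq 'I_e := flatten [seq nseq (p l) l | l <- enum 'I_e].

Lemma mpartial_pder p f : mpartial p f = pder (mword p) f.
Proof.
rewrite /mpartial /mword /pder; elim: (enum _) => //= l s ->.
by rewrite foldr_cat; elim: (p l) => //= n ->.
Qed.

Lemma count_mword p l : count_mem l (mword p) = p l.
Proof.
rewrite /mword count_flatten -map_comp sumnE big_map big_enum /=.
rewrite (bigD1 l)//= big1 ?addn0 => [|k kl].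
  by rewrite count_nseq /= eqxx mul1n.
by rewrite count_nseq /= (negbTE kl).
Qed.

Lemma size_mword p : size (mword p) = mdeg p.
Proof.
rewrite /mword size_flatten /shape -map_comp sumnE big_map big_enum /=.
by apply: eq_bigr => l _; rewrite size_nseq.
Qed.

Lemma mpartial_classC p k f : classC (mdeg p + k) f -> classC k (mpartial p f).
Proof. by rewrite mpartial_pder -size_mword; exact: pder_classC. Qed.

Lemma partial_mpartial p l f : classC (mdeg p).+1 f ->
  partial l (mpartial p f) = mpartial (p + mone l) f.
Proof.
move=> fC; rewrite !mpartial_pder -[LHS]/(pder (l :: mword p) f).
apply: pder_perm; last by rewrite /= size_mword.
apply/allP => k _ /=.
by rewrite !count_mword maddE ffunE addnC [l == k]eq_sym.
Qed.

Definition mmono h i : R := (mfact i)%:R^-1 * mpow h i.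

Lemma mmono00 h : mmono h 0 = 1.
Proof.
rewrite /mmono /mfact /mpow !big1 ?invr1 ?mulr1// => l _.
  by rewrite ffunE expr0.
by rewrite ffunE.
Qed.

Lemma mmono0 i : mmono 0 i = (i == 0)%:R.
Proof.
have [->|i0] := eqVneq i 0; first exact: mmono00.
have [l il] : exists l, i l != 0%N.
  apply/existsP; apply: contraNT i0; rewrite negb_exists => /forallP h.
  by apply/eqP/ffunP => l; rewrite ffunE; apply/eqP/negPn/h.
rewrite /mmono /mpow (bigD1 l)//= mxE expr0n.
by case: (i l) il => //= n _; rewrite mul0r mulr0.
Qed.

Lemma is_derive_mmono h l (c t : R) i :
  is_derive t (1 : R) (fun u : R => mmono (h + (u * c) *: ev l) i)
    (c * (if (0 < i l)%N then mmono (h + (t * c) *: ev l) (msub i (mone l)) else 0)).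
Proof.
pose r := \prod_(k < e | k != l) h 0 k ^+ i k.
pose w := (\prod_(k < e | k != l) (i k)`!)%N.
have monoE (j : mindex e) : (forall k, k != l -> j k = i k) -> forall u : R,
    mmono (h + u *: ev l) j = ((j l)`! * w)%N%:R^-1 * ((h 0 l + u) ^+ j l * r).
  move=> ji u; rewrite /mmono /mpow /mfact (bigD1 l)//= [X in _ * X](bigD1 l)//=.
  rewrite !mxE !eqxx mulr1; congr (((_ * _)%N%:R)^-1 * (_ * _)).
    by apply: eq_bigr => k kl; rewrite ji.
  by apply: eq_bigr => k kl; rewrite !mxE eqxx (negbTE kl) mulr0 addr0 ji.
have w0 : (w%:R : R) != 0.
  by rewrite pnatr_eq0 -lt0n; apply: prodn_gt0 => k; exact: fact_gt0.
have d : is_derive t (1 : R) (fun u : R => h 0 l + u * c) c.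
  by apply: is_derive_eq; rewrite add0r mul1r scaler0 add0r; exact: mulr1.
rewrite (_ : (fun u : R => _) =
    (((i l)`! * w)%N%:R^-1 * r) \*: ((fun u : R => h 0 l + u * c) ^+ i l)); last first.
  apply/funext => u; rewrite monoE// exprfctE.
  by rewrite [_ ^+ _ * r]mulrC mulrA.
apply: is_derive_eq; rewrite /GRing.scale/=.
case: posnP => [->|il]; first by rewrite !mul0r !mulr0.
rewrite monoE; last first.
  by move=> k kl; rewrite !ffunE (negbTE kl) subn0.
rewrite !ffunE eqxx subn1.
case: (i l) il => // n _; rewrite /= factS !natrM.
by field; rewrite w0 nat1r !pnatr_eq0 -lt0n fact_gt0.
Qed.

End MultiDerivatives.

(** * Mean value estimates along the coordinates *)
Section Taylor.
Variables (R : realType) (e : nat).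
Local Notation V := 'rV[R]_e.
Local Notation ev l := (delta_mx 0 l : V).
Implicit Types (f g : V -> R) (x h : V) (i p q : mindex e).

Lemma bounded_on_box g (B : R) : continuous g ->
  exists2 C : R, 0 <= C & forall x, (forall j, `|x 0 j| <= B) -> `|g x| <= C.
Proof.
move=> cg.
have K : compact (g @` [set v : V | forall j, `[- B, B]%classic (v ord0 j)]).
  apply: continuous_compact; first exact: continuous_subspaceT.
  by apply: (@rV_compact _ _ (fun=> `[- B, B]%classic)) => j; exact: segment_compact.
have [M [_ MP]] := compact_bounded K.
exists `|M + 1| => // x xB; apply: le_trans (ler_norm _).
apply: MP; first by rewrite ltrDl.
exists x => // j /=; rewrite in_itv/= -ler_norml; exact: xB.
Qed.

(** The path that runs from 0 to h by moving one coordinate after the other, so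
    that partial derivatives are the only derivatives needed along it. *)
Definition staircase (l : nat) (t : R) h : V :=
  \row_j (if (j < l)%N then h 0 j else if j == l :> nat then t * h 0 j else 0).

Lemma staircase_line (l : 'I_e) t h :
  staircase l t h = staircase l 0 h + (t * h 0 l) *: ev l.
Proof.
apply/rowP => j; rewrite !mxE eqxx /= -val_eqE /=.
case: (ltngtP j l) => [jl|jl|/val_inj ->].
- by rewrite mulr0 addr0.
- by rewrite mulr0 addr0.
- by rewrite mul0r add0r mulr1.
Qed.

Lemma staircase_step l h : staircase l 1 h = staircase l.+1 0 h.
Proof.
apply/rowP => j; rewrite !mxE ltnS.
by case: (ltngtP j l) => // jl; rewrite ?mul1r// mul0r; case: ifP.
Qed.

Lemma staircase0 h : staircase 0 0 h = 0.
Proof. by apply/rowP => j; rewrite !mxE mul0r; case: ifP. Qed.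

Lemma staircase_end h : staircase e 0 h = h.
Proof. by apply/rowP => j; rewrite !mxE ltn_ord. Qed.

Lemma staircase_le l t h j : 0 <= t -> t <= 1 -> `|staircase l t h 0 j| <= `|h 0 j|.
Proof.
move=> t0 t1; rewrite mxE; case: ifP => // _; case: ifP => // _; last by rewrite normr0.
by rewrite normrM ger0_norm// ler_piMl.
Qed.

Lemma staircaseB l t h h' :
  staircase l t h - staircase l t h' = staircase l t (h - h').
Proof.
apply/rowP => j; rewrite !mxE; case: ifP => // _; case: ifP => // _.
  by rewrite mulrBr.
by rewrite subr0.
Qed.

(** The two arguments of F move in parallel, which serves to estimate the difference
    of two values of one function, or of two functions, by a single use of the
    mean value theorem per coordinate. *)
Lemma staircase_mvt (F : V -> V -> R) (dF : 'I_e -> V -> V -> R) h h' (B : R) :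
  (forall (l : 'I_e) k k' t, is_derive t (1 : R)
     (fun u : R => F (k + (u * h 0 l) *: ev l) (k' + (u * h' 0 l) *: ev l))
     (dF l (k + (t * h 0 l) *: ev l) (k' + (t * h' 0 l) *: ev l))) ->
  (forall (l : 'I_e) t, 0 <= t -> t <= 1 ->
     `|dF l (staircase l t h) (staircase l t h')| <= B) ->
  `|F h h' - F 0 0| <= e%:R * B.
Proof.
move=> d b.
suff : forall n, (n <= e)%N ->
    `|F (staircase n 0 h) (staircase n 0 h') - F 0 0| <= n%:R * B.
  by move=> /(_ e (leqnn e)); rewrite !staircase_end.
elim=> [|n IH] ne; first by rewrite !staircase0 subrr normr0 mul0r.
have {}IH := IH (ltnW ne).
rewrite -!staircase_step -natr1 mulrDl mul1r.
have := @mvt_bound _ (fun u => F (staircase n u h) (staircase n u h'))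
  (fun u => dF (Ordinal ne) (staircase n u h) (staircase n u h')) B.
move=> /(_ _ (b (Ordinal ne)))-/(_ _)/= step.
have {}step : `|F (staircase n 1 h) (staircase n 1 h') - F (staircase n 0 h) (staircase n 0 h')| <= B.
  apply: step => t.
  have lineE u k : staircase n u k = staircase n 0 k + (u * k 0 (Ordinal ne)) *: ev (Ordinal ne).
    exact: (staircase_line (Ordinal ne)).
  rewrite (lineE t h) (lineE t h').
  rewrite (_ : (fun u => _) = (fun u : R =>
    F (staircase n 0 h + (u * h 0 (Ordinal ne)) *: ev (Ordinal ne))
      (staircase n 0 h' + (u * h' 0 (Ordinal ne)) *: ev (Ordinal ne)))).
    exact: d.
  by apply/funext => u; rewrite (lineE u h) (lineE u h').
by rewrite -(subrKA (F (staircase n 0 h) (staircase n 0 h'))) addrC (le_trans (ler_normD _ _))// lerD.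
Qed.

Lemma lipschitz_on_box g (B : R) : classC 1 g ->
  exists2 C : R, 0 <= C & forall (x y : V) (eps : R), (forall j, `|x 0 j| <= B) ->
    (forall j, `|y 0 j| <= B) -> (forall j, `|y 0 j - x 0 j| <= eps) ->
    `|g y - g x| <= C * eps.
Proof.
move=> gC.
have /choice[C CP] l : exists c : R, 0 <= c /\ forall x,
    (forall j, `|x 0 j| <= 3 * B) -> `|partial l g x| <= c.
  have /(bounded_on_box (3 * B))[c c0 cP] : continuous (partial l g).
    by apply: (@classC_continuous _ _ 0); exact: classC_partial.
  by exists c.
exists (e%:R * \sum_l C l); first by rewrite mulr_ge0// sumr_ge0// => l _; case: (CP l).
move=> x y eps xB yB xy.
have [e0|e0] := posnP e.
  have -> : y = x by apply/rowP => j; have := ltn_ord j; rewrite {2}e0.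
  have -> : e%:R = 0 :> R by rewrite e0.
  by rewrite subrr normr0 !mul0r.
have eps0 : 0 <= eps := le_trans (normr_ge0 _) (xy (Ordinal e0)).
pose h := y - x.
have -> : g y - g x = g (x + h) - g (x + 0) by rewrite /h (addrC x (y - x)) subrK addr0.
rewrite -mulrA.
apply: (@staircase_mvt (fun k _ => g (x + k))
  (fun l k _ => h 0 l * partial l g (x + k)) h h).
  move=> l k _ t; rewrite addrA.
  rewrite (_ : (fun u => _) = (fun u : R => g (x + k + (u * h 0 l) *: ev l))).
    by apply: is_derive_coord; exact: classC_derivable gC.
  by apply/funext => u; rewrite addrA.
move=> l t t0 t1; rewrite normrM mulrC; apply: ler_pM => //.
  have [Cl /(_ (x + staircase l t h)) b] := CP l.
  apply: (@le_trans _ _ (C l)).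
    apply: b => j; rewrite mxE; apply: le_trans (ler_normD _ _) _.
    have := staircase_le l h j t0 t1; move: (xB j) (yB j).
    rewrite [h 0 j]mxE [(- x) 0 j]mxE => ? ? /le_trans/(_ (ler_normB _ _)) ?; lra.
  by rewrite (bigD1 l)//= lerDl sumr_ge0// => k _; case: (CP k).
by rewrite /h !mxE.
Qed.

End Taylor.

(** * Taylor remainders *)
Section TaylorRemainder.
Variables (R : realType) (e : nat) (N : nat) (f : 'rV[R]_e -> R).
Hypothesis f_C : classC N.+1 f.
Local Notation V := 'rV[R]_e.
Local Notation ev l := (delta_mx 0 l : V).
Implicit Types (x h : V) (i p q : mindex e) (m : nat).

Definition taylor p m x h : R :=
  \sum_(i <- mlow e N.+1 | (mdeg i < m)%N) mpartial (p + i) f x * mmono h i.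

Definition taylor_rem p m x h : R := mpartial p f (x + h) - taylor p m x h.

Lemma mpartial_classC1 p : (mdeg p <= N)%N -> classC 1 (mpartial p f).
Proof. by move=> pN; apply: mpartial_classC; apply: classC_le f_C; rewrite addn1. Qed.

Lemma taylor_rem0 p x h : taylor_rem p 0 x h = mpartial p f (x + h).
Proof. by rewrite /taylor_rem /taylor big_pred0 ?subr0. Qed.

Lemma taylor_rem_at0 p m x : taylor_rem p m.+1 x 0 = 0.
Proof.
rewrite /taylor_rem /taylor big_mkcond (bigD1_seq 0) ?mlow_uniq ?mem_mlow ?mdeg0//=.
rewrite big1 => [|i i0]; last by rewrite mmono0 (negbTE i0) mulr0 if_same.
by rewrite mmono00 mulr1 !addr0 subrr.
Qed.

(** The derivative of a Taylor remainder in the increment is the Taylor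
    remainder, one order lower, of the derivative. *)
Lemma is_derive_taylor_rem p m x h l (c t : R) : (mdeg p + m < N)%N ->
  is_derive t (1 : R) (fun u : R => taylor_rem p m.+1 x (h + (u * c) *: ev l))
    (c * taylor_rem (p + mone l) m x (h + (t * c) *: ev l)).
Proof.
move=> pmN; set k := h + _.
have pN : (mdeg p < N)%N by apply: leq_ltn_trans pmN; exact: leq_addr.
rewrite /taylor_rem mulrBr.
apply: is_deriveB.
  rewrite -partial_mpartial; last by apply: classC_le f_C; exact: ltnW.
  rewrite (_ : (fun u : R => _) = (fun u : R => mpartial p f (x + h + (u * c) *: ev l))); last first.
    by apply/funext => u; rewrite addrA.
  rewrite /k addrA; apply: is_derive_coord.
  by apply: (@classC_derivable _ _ 0); apply: mpartial_classC1; exact: ltnW.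
rewrite /taylor.
rewrite (_ : c * _ = \sum_(i <- mlow e N.+1 | (mdeg i < m.+1)%N)
    mpartial (p + i) f x * (c * (if (0 < i l)%N then mmono k (msub i (mone l)) else 0))).
  apply: is_derive_bigsum => i _.
  have := @is_deriveZ _ _ _ _ (mpartial (p + i) f x) t 1 _ (is_derive_mmono h l c t i).
  by [].
rewrite [RHS](eq_bigr (fun i => if mleb (mone l) i then
    c * (mpartial (p + i) f x * mmono k (msub i (mone l))) else 0)); last first.
  move=> i _; have -> : mleb (mone l) i = (0 < i l)%N.
    apply/mlebP/idP => [/(_ l)|il j]; first by rewrite ffunE eqxx.
    by rewrite ffunE; case: eqVneq => [->|].
  by case: ifP => _; rewrite ?mulr0// mulrCA.
rewrite -big_mkcondr (eq_bigl (fun i => mleb (mone l) i && (mdeg i < m.+1)%N)); last first.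
  by move=> i; rewrite andbC.
rewrite (sum_mlow_shift (P := fun i => (mdeg i < m.+1)%N)); last first.
  move=> i im _; apply: (leq_trans im); rewrite ltnS; apply: leq_trans (ltnW pmN).
  exact: leq_addl.
rewrite mulr_sumr; apply: eq_big => [i|i _].
  by rewrite mdegD mdeg_mone add1n ltnS.
by rewrite maddKC addrA.
Qed.

(** Induction on m: along the staircase, the partial derivatives of a remainder of
    order m + 1 are remainders of order m. For m = 0 the remainder is a
    derivative of f of order at most N; being of class C^1 it is bounded and
    Lipschitz on boxes. The induction step only splits a difference of products. *)
Lemma taylor_rem_bound (B H : R) : 0 <= B -> 0 <= H -> forall m p, (mdeg p + m <= N)%N ->
  exists2 C : R, 0 <= C & forall (x x' h h' : V) (eta eps : R),
    0 <= eta -> eta <= H -> 0 <= eps ->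
    (forall j, `|x 0 j| <= B) -> (forall j, `|x' 0 j| <= B) ->
    (forall j, `|h 0 j| <= B * eta) -> (forall j, `|h' 0 j| <= B * eta) ->
    (forall j, `|x 0 j - x' 0 j| <= eps) -> (forall j, `|h 0 j - h' 0 j| <= eps * eta) ->
    `|taylor_rem p m x h| <= C * eta ^+ m /\
    `|taylor_rem p m x h - taylor_rem p m x' h'| <= C * eps * eta ^+ m.
Proof.
move=> B0 H0; elim=> [|m IH] p.
  rewrite addn0 => pN; have gC := mpartial_classC1 pN.
  have BH : forall (x h : V) eta, eta <= H -> (forall j, `|x 0 j| <= B) ->
      (forall j, `|h 0 j| <= B * eta) -> forall j, `|(x + h) 0 j| <= B + B * H.
    move=> x h eta etaH xB hB j; rewrite mxE (le_trans (ler_normD _ _))// lerD//.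
    by apply: le_trans (hB j) _; apply: ler_wpM2l.
  have [C1 C10 b1] := bounded_on_box (B + B * H) (classC_continuous gC).
  have [C2 C20 b2] := lipschitz_on_box (B + B * H) gC.
  exists (C1 + C2 * (1 + H)).
    by rewrite addr_ge0// mulr_ge0// addr_ge0.
  move=> x x' h h' eta eps eta0 etaH eps0 xB x'B hB h'B xx' hh'.
  rewrite !taylor_rem0 !expr0 !mulr1; split.
    apply: (le_trans (b1 _ (BH _ _ _ etaH xB hB))); rewrite lerDl.
    by rewrite mulr_ge0// addr_ge0.
  apply: (@le_trans _ _ (C2 * ((1 + H) * eps))); last first.
    by rewrite mulrA; apply: ler_wpM2r => //; rewrite lerDr.
  apply: b2; [exact: BH etaH x'B h'B|exact: BH etaH xB hB|].
  move=> j; rewrite !mxE (_ : _ - _ = (x 0 j - x' 0 j) + (h 0 j - h' 0 j)); last by ring.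
  apply: (le_trans (ler_normD _ _)); rewrite mulrDl mul1r lerD//.
  by apply: (le_trans (hh' j)); rewrite mulrC ler_wpM2r.
rewrite addnS => pmN.
have /choice[C CP] l : exists C : R, 0 <= C /\ forall (x x' h h' : V) (eta eps : R),
    0 <= eta -> eta <= H -> 0 <= eps ->
    (forall j, `|x 0 j| <= B) -> (forall j, `|x' 0 j| <= B) ->
    (forall j, `|h 0 j| <= B * eta) -> (forall j, `|h' 0 j| <= B * eta) ->
    (forall j, `|x 0 j - x' 0 j| <= eps) -> (forall j, `|h 0 j - h' 0 j| <= eps * eta) ->
    `|taylor_rem (p + mone l) m x h| <= C * eta ^+ m /\
    `|taylor_rem (p + mone l) m x h - taylor_rem (p + mone l) m x' h'| <= C * eps * eta ^+ m.
  have [|c c0 cP] := IH (p + mone l); first by rewrite mdegD mdeg_mone addn1 addSn.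
  by exists c.
pose D := \sum_l C l.
have D0 : 0 <= D by rewrite sumr_ge0// => l _; case: (CP l).
have CD l : C l <= D by rewrite /D (bigD1 l)//= lerDl sumr_ge0// => k _; case: (CP k).
exists (e%:R * ((B + 1) * D)); first by rewrite !mulr_ge0// addr_ge0.
move=> x x' h h' eta eps eta0 etaH eps0 xB x'B hB h'B xx' hh'.
have IHl l t : 0 <= t -> t <= 1 ->
    `|taylor_rem (p + mone l) m x (staircase l t h)| <= D * eta ^+ m /\
    `|taylor_rem (p + mone l) m x' (staircase l t h')| <= D * eta ^+ m /\
    `|taylor_rem (p + mone l) m x (staircase l t h)
      - taylor_rem (p + mone l) m x' (staircase l t h')| <= D * eps * eta ^+ m.
  move=> t0 t1; have [_ b] := CP l.
  have sB (k : V) : (forall j, `|k 0 j| <= B * eta) -> forall j, `|staircase l t k 0 j| <= B * eta.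
    by move=> kB j; apply: le_trans (kB j); exact: staircase_le.
  have sD j : `|staircase l t h 0 j - staircase l t h' 0 j| <= eps * eta.
    have -> : staircase l t h 0 j - staircase l t h' 0 j = staircase l t (h - h') 0 j.
      by rewrite -staircaseB !mxE.
    by apply: (le_trans (staircase_le _ _ _ t0 t1)); rewrite !mxE.
  have zero (k : V) j : `|k 0 j - k 0 j| <= 0 :> R by rewrite subrr normr0.
  have z' (k : V) j : `|k 0 j - k 0 j| <= 0 * eta :> R by rewrite subrr normr0 mul0r.
  have [b1 b3] := b x x' _ _ eta eps eta0 etaH eps0 xB x'B (sB _ hB) (sB _ h'B) xx' sD.
  have [b2 _] := b x' x' _ _ eta 0 eta0 etaH (lexx 0) x'B x'B (sB _ h'B) (sB _ h'B) (zero x') (z' (staircase l t h')).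
  have em : 0 <= eta ^+ m by exact: exprn_ge0.
  split; [|split].
  - by apply: (le_trans b1); exact: ler_wpM2r.
  - by apply: (le_trans b2); exact: ler_wpM2r.
  - by apply: (le_trans b3); apply: ler_wpM2r => //; exact: ler_wpM2r.
have BD : B * D <= (B + 1) * D by apply: ler_wpM2r => //; rewrite lerDl.
have em : 0 <= eta ^+ m.+1 by exact: exprn_ge0.
split.
  rewrite -[X in `|X|]subr0 -(taylor_rem_at0 p m x) -mulrA.
  apply: (@staircase_mvt _ _ (fun k _ => taylor_rem p m.+1 x k)
    (fun l k _ => h 0 l * taylor_rem (p + mone l) m x k) h h).
    by move=> l k _ t; exact: is_derive_taylor_rem.
  move=> l t t0 t1; have [b _] := IHl l t t0 t1.
  rewrite normrM; apply: (@le_trans _ _ (B * eta * (D * eta ^+ m))); first exact: ler_pM.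
  rewrite (_ : B * eta * _ = B * D * eta ^+ m.+1); first exact: ler_wpM2r.
  by rewrite exprS; ring.
have -> : taylor_rem p m.+1 x h - taylor_rem p m.+1 x' h' =
    taylor_rem p m.+1 x h - taylor_rem p m.+1 x' h'
    - (taylor_rem p m.+1 x 0 - taylor_rem p m.+1 x' 0).
  by rewrite !taylor_rem_at0 !subr0.
rewrite -!mulrA.
apply: (@staircase_mvt _ _ (fun k k' => taylor_rem p m.+1 x k - taylor_rem p m.+1 x' k')
    (fun l k k' => h 0 l * taylor_rem (p + mone l) m x k
       - h' 0 l * taylor_rem (p + mone l) m x' k') h h').
  by move=> l k k' t; apply: is_deriveB; exact: is_derive_taylor_rem.
move=> l t t0 t1; have [b1 [b2 b3]] := IHl l t t0 t1.
set r := taylor_rem _ m x _ in b1 b3 *; set r' := taylor_rem _ m x' _ in b2 b3 *.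
rewrite (_ : _ - _ = h 0 l * (r - r') + (h 0 l - h' 0 l) * r'); last by ring.
apply: (le_trans (ler_normD _ _)); rewrite !normrM.
apply: (@le_trans _ _ (B * eta * (D * eps * eta ^+ m) + eps * eta * (D * eta ^+ m))).
  by apply: lerD; apply: ler_pM.
by rewrite le_eqVlt; apply/orP; left; apply/eqP; rewrite exprS; ring.
Qed.

End TaylorRemainder.

(** * Lipschitz families of a given order *)
Section LipschitzFamilies.
Variables (R : realType) (P : Type) (good : P -> Prop) (close : P -> P -> R -> Prop) (T : R).
Hypothesis close_refl : forall X, close X X 0.
Hypothesis close_ge0 : forall X Y eps, close X Y eps -> 0 <= eps.

Section Calculus.
Variables (S : Type) (dom : S -> Prop) (len : S -> R).
Hypothesis len_bnd : forall s, dom s -> 0 < len s <= T.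
Implicit Types (a b : P -> S -> R) (g : R).

(** An order estimate that carries along its Lipschitz version in the parameter X;
    the constant C is common to all good parameters. As every X is close to itself
    with eps = 0, the first bound holds for each good X alone. *)
Definition lipO g a := exists2 C, 0 <= C & forall X Y eps,
  good X -> good Y -> close X Y eps -> forall s, dom s ->
  `|a X s| <= C * len s `^ g /\ `|a X s - a Y s| <= C * eps * len s `^ g.

Lemma lipO_ext g a b : lipO g a ->
  (forall X s, good X -> dom s -> b X s = a X s) -> lipO g b.
Proof.
move=> [C C0 h] ab; exists C => // X Y eps gX gY cXY s ds.
by rewrite !ab//; exact: h.
Qed.

Lemma lipOM g1 g2 a b : lipO g1 a -> lipO g2 b ->
  lipO (g1 + g2) (fun X s => a X s * b X s).
Proof.
move=> [C1 C10 h1] [C2 C20 h2]; exists (2 * (C1 * C2)).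
  by rewrite mulr_ge0// mulr_ge0.
move=> X Y eps gX gY cXY s ds.
have [a1 a2] := h1 X Y eps gX gY cXY s ds.
have [b1 b2] := h2 X Y eps gX gY cXY s ds.
have [a3 _] := h1 Y Y 0 gY gY (close_refl Y) s ds.
have /andP[l0 _] := len_bnd ds.
rewrite powRD; last by rewrite (gt_eqF l0) implybT.
have p1 := powR_ge0 (len s) g1; have p2 := powR_ge0 (len s) g2.
have e0 := close_ge0 cXY.
move: (len s `^ g1) (len s `^ g2) p1 p2 a1 a2 b1 b2 a3 => p q p0 q0 a1 a2 b1 b2 a3.
have pq0 : 0 <= C1 * C2 * (p * q) by rewrite !mulr_ge0.
split.
  rewrite normrM; apply: (@le_trans _ _ (C1 * C2 * (p * q))).
    by rewrite (mulrACA C1); exact: ler_pM.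
  by rewrite -[leRHS]mulrA ler_peMl// ler1n.
rewrite (_ : _ - _ = (a X s - a Y s) * b X s + a Y s * (b X s - b Y s)); last by ring.
apply: (le_trans (ler_normD _ _)); rewrite !normrM.
rewrite (_ : 2 * _ * _ * _ = C1 * eps * p * (C2 * q) + C1 * p * (C2 * eps * q)); last by ring.
by apply: lerD; apply: ler_pM.
Qed.

Lemma lipOD g a b : lipO g a -> lipO g b -> lipO g (fun X s => a X s + b X s).
Proof.
move=> [C1 C10 h1] [C2 C20 h2]; exists (C1 + C2); first exact: addr_ge0.
move=> X Y eps gX gY cXY s ds.
have [a1 a2] := h1 X Y eps gX gY cXY s ds.
have [b1 b2] := h2 X Y eps gX gY cXY s ds.
split; first by apply: (le_trans (ler_normD _ _)); rewrite mulrDl lerD.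
rewrite (_ : _ - _ = (a X s - a Y s) + (b X s - b Y s)); last by ring.
by apply: (le_trans (ler_normD _ _)); rewrite !mulrDl lerD.
Qed.

Lemma lipON g a : lipO g a -> lipO g (fun X s => - a X s).
Proof.
move=> [C C0 h]; exists C => // X Y eps gX gY cXY s ds.
by rewrite -opprD !normrN; exact: h.
Qed.

(** Lengths are bounded by T, so that a higher order is a stronger statement. *)
Lemma lipO_weak g g' a : g' <= g -> lipO g a -> lipO g' a.
Proof.
move=> gg [C C0 h]; exists (C * T `^ (g - g')); first by rewrite mulr_ge0// powR_ge0.
move=> X Y eps gX gY cXY s ds; have [a1 a2] := h X Y eps gX gY cXY s ds.
have /andP[l0 lT] := len_bnd ds.
have step : len s `^ g <= T `^ (g - g') * len s `^ g'.
  rewrite -{1}(subrK g' g) (@powRD _ (len s)); last by rewrite (gt_eqF l0) implybT.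
  apply: ler_wpM2r; first exact: powR_ge0.
  by apply: ge0_ler_powR; rewrite ?nnegrE ?subr_ge0 ?(ltW l0) ?(le_trans (ltW l0) lT).
split.
  by apply: (le_trans a1); rewrite -mulrA; exact: ler_wpM2l.
apply: (le_trans a2); rewrite (mulrAC C (T `^ _)) -[leRHS]mulrA.
by apply: ler_wpM2l => //; rewrite mulr_ge0// (close_ge0 cXY).
Qed.

Lemma lipO_cst c : lipO 0 (fun _ _ => c).
Proof.
exists `|c| => // X Y eps gX gY cXY s ds.
by rewrite powRr0 !mulr1 subrr normr0 mulr_ge0// (close_ge0 cXY).
Qed.

Lemma lipO0 g : lipO g (fun _ _ => 0).
Proof.
by exists 0 => // X Y eps gX gY cXY s ds; rewrite subrr normr0 !mul0r.
Qed.

Lemma lipO_sum g (I : eqType) (r : seq I) (Q : pred I) (F : I -> P -> S -> R) :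
  (forall i, i \in r -> Q i -> lipO g (F i)) ->
  lipO g (fun X s => \sum_(i <- r | Q i) F i X s).
Proof.
elim: r => [|i r IH] h.
  by apply: lipO_ext (lipO0 g) _ => X s _ _; rewrite big_nil.
have {}IH : lipO g (fun X s => \sum_(i <- r | Q i) F i X s).
  by apply: IH => j jr; apply: h; rewrite in_cons jr orbT.
have [Qi|nQi] := boolP (Q i).
  have hi := h i (mem_head _ _) Qi.
  by apply: lipO_ext (lipOD hi IH) _ => X s _ _; rewrite big_cons Qi.
by apply: lipO_ext IH _ => X s _ _; rewrite big_cons (negbTE nQi).
Qed.

Lemma lipO_prod (I : eqType) (r : seq I) (w : I -> R) (F : I -> P -> S -> R) :
  (forall i, lipO (w i) (F i)) ->
  lipO (\sum_(i <- r) w i) (fun X s => \prod_(i <- r) F i X s).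
Proof.
move=> h; elim: r => [|i r IH].
  by rewrite big_nil; apply: lipO_ext (lipO_cst 1) _ => X s _ _; rewrite big_nil.
by rewrite big_cons; apply: lipO_ext (lipOM (h i) IH) _ => X s _ _; rewrite big_cons.
Qed.

Lemma lipOX g a k : lipO g a -> lipO (k%:R * g) (fun X s => a X s ^+ k).
Proof.
move=> h; elim: k => [|k IH].
  by rewrite mul0r; exact: lipO_cst.
rewrite -natr1 mulrDl mul1r addrC.
by apply: lipO_ext (lipOM h IH) _ => X s _ _; rewrite exprS.
Qed.

End Calculus.

Lemma lipO_comp S S' (dom : S -> Prop) (dom' : S' -> Prop) (len : S -> R) (len' : S' -> R)
    (phi : S' -> S) g (a : P -> S -> R) : 0 <= g ->
  (forall s, dom s -> 0 <= len s) ->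
  (forall s', dom' s' -> dom (phi s') /\ len (phi s') <= len' s') ->
  lipO dom len g a -> lipO dom' len' g (fun X s' => a X (phi s')).
Proof.
move=> g0 l0 h [C C0 b]; exists C => // X Y eps gX gY cXY s' ds'.
have [ds ll] := h _ ds'; have [b1 b2] := b X Y eps gX gY cXY _ ds.
have pp : len (phi s') `^ g <= len' s' `^ g.
  by apply: ge0_ler_powR; rewrite ?nnegrE ?(le_trans (l0 _ ds) ll) ?l0.
split; first by apply: (le_trans b1); exact: ler_wpM2l.
by apply: (le_trans b2); apply: ler_wpM2l => //; rewrite mulr_ge0// (close_ge0 cXY).
Qed.

Definition dom2 (st : R * R) := [/\ 0 <= st.1, st.1 < st.2 & st.2 <= T].
Definition len2 (st : R * R) := st.2 - st.1.
Definition dom3 (sut : R * R * R) :=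
  [/\ 0 <= sut.1.1, sut.1.1 < sut.1.2, sut.1.2 < sut.2 & sut.2 <= T].
Definition len3 (sut : R * R * R) := sut.2 - sut.1.1.

Lemma len2_bnd s : dom2 s -> 0 < len2 s <= T.
Proof. by case: s => s t [/= s0 st tT]; rewrite /len2 /=; apply/andP; split; lra. Qed.

Lemma len3_bnd s : dom3 s -> 0 < len3 s <= T.
Proof.
by case: s => -[s u] t [/= s0 su ut tT]; rewrite /len3 /=; apply/andP; split; lra.
Qed.

Lemma lipO_su g (a : P -> R * R -> R) : 0 <= g -> lipO dom2 len2 g a ->
  lipO dom3 len3 g (fun X s => a X (s.1.1, s.1.2)).
Proof.
move=> g0; apply: (lipO_comp (phi := fun s : R * R * R => (s.1.1, s.1.2))) => //.
  by move=> s /len2_bnd/andP[/ltW].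
by move=> [[s u] t] [/= s0 su ut tT]; rewrite /dom2/len2/len3 /=; split; [split|]; lra.
Qed.

Lemma lipO_ut g (a : P -> R * R -> R) : 0 <= g -> lipO dom2 len2 g a ->
  lipO dom3 len3 g (fun X s => a X (s.1.2, s.2)).
Proof.
move=> g0; apply: (lipO_comp (phi := fun s : R * R * R => (s.1.2, s.2))) => //.
  by move=> s /len2_bnd/andP[/ltW].
by move=> [[s u] t] [/= s0 su ut tT]; rewrite /dom2/len2/len3 /=; split; [split|]; lra.
Qed.

(** Sewing preserves Lipschitz families: the maximal inequality bounds the distance
    of the limit to the germ, and, applied to the difference of the germs of X and
    Y, it bounds the difference of these distances. The germ may depend on a base
    point s0, as the one of the second level does, but its defect may not. *)
Section SewingFamily.
Variables (A : P -> R -> R -> R -> R) (D : P -> R * R * R -> R) (theta : R).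
Hypothesis theta_gt1 : 1 < theta.
Hypothesis defectE : forall X s0 s u t, good X -> 0 <= s0 -> s0 <= s -> s < u -> u < t -> t <= T ->
  A X s0 s t - A X s0 s u - A X s0 u t = D X (s, u, t).
Hypothesis lipD : lipO dom3 len3 theta D.

Lemma sewable_family X s0 s t : good X -> 0 <= s0 -> s0 <= s -> s <= t -> t <= T ->
  sewable (A X s0) s t.
Proof.
move=> gX s00 s0s st tT; case: lipD => C C0 h.
apply: (@sewing_cvg R (A X s0) s0 T theta C) => // s' u t' s0s' su ut t'T.
rewrite defectE//; have [] := h X X 0 gX gX (close_refl X) (s', u, t') => //.
by split=> //=; exact: le_trans s0s'.
Qed.

Lemma lipO_sewing :
  lipO dom2 len2 theta (fun X s => sewing (A X s.1) s.1 s.2 - A X s.1 s.1 s.2).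
Proof.
case: lipD => C C0 h.
pose c := sewing_const theta.
have c0 : 0 <= c by rewrite divr_ge0// ltW// half_powR_lt.
exists (c * C); first exact: mulr_ge0.
move=> X Y eps gX gY cXY [s t] [/= s0 st tT]; have e0 := close_ge0 cXY.
have sX := sewable_family gX s0 (lexx s) (ltW st) tT.
have sY := sewable_family gY s0 (lexx s) (ltW st) tT.
have [z0 sz] := @sewing_cst0 R s t (ltW st).
have dX s' u t' : s <= s' -> s' < u -> u < t' -> t' <= T ->
    `|A X s s' t' - A X s s' u - A X s u t'| <= C * (t' - s') `^ theta /\
    `|(A X s s' t' - A X s s' u - A X s u t')
     - (A Y s s' t' - A Y s s' u - A Y s u t')| <= C * eps * (t' - s') `^ theta.
  move=> ss' s'u ut' t'T; rewrite !defectE//.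
  have [] := h X Y eps gX gY cXY (s', u, t'); last by [].
  by split=> //=; exact: le_trans ss'.
rewrite /len2 /=; split.
  have := @sewing_close R (A X s) (fun _ _ => 0) s t (A X s s t)
    (c * C * (t - s) `^ theta) (ltW st) sX z0; rewrite sz subr0; apply.
  move=> r pr; rewrite -rsumB.
  rewrite (_ : (fun x y : R => _) = A X s); last first.
    by apply/funext => x; apply/funext => y; rewrite subr0.
  apply: (sewing_maximal (lo := s) (hi := T)) => // s' u t' h1 h2 h3 h4.
  by have [] := dX s' u t' h1 h2 h3 h4.
rewrite (_ : _ - _ = sewing (A X s) s t - sewing (A Y s) s t - (A X s s t - A Y s s t)); last by ring.
apply: sewing_close => //; first exact: ltW.
move=> r pr; rewrite -rsumB -(mulrA c).
apply: (sewing_maximal (A := fun x y => A X s x y - A Y s x y) (lo := s) (hi := T)) => //.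
  exact: mulr_ge0.
move=> s' u t' h1 h2 h3 h4; have [_ b] := dX s' u t' h1 h2 h3 h4.
apply: le_trans b; rewrite le_eqVlt; apply/orP; left; apply/eqP; congr `|_|; ring.
Qed.

End SewingFamily.

End LipschitzFamilies.

(** * The components of a rough path as Lipschitz families *)
Section MultiIndexPowers.
Variables (R : realType) (e : nat).
Implicit Types (h : 'rV[R]_e) (i p q : mindex e).

Lemma mpowD h p q : mpow h (p + q) = mpow h p * mpow h q.
Proof. by rewrite /mpow -big_split; apply: eq_bigr => l _; rewrite maddE exprD. Qed.

Lemma msubD p q j k : mle p j -> mle q k -> msub (msub (j + k) p) q = msub j p + msub k q.
Proof.
move=> pj qk; apply/ffunP => l; rewrite maddE [LHS]ffunE 3![msub _ _ l]ffunE maddE.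
by have := pj l; have := qk l; lia.
Qed.

End MultiIndexPowers.

Section PathEstimates.
Variables (R : realType) (d e : nat) (T alpha beta : R) (N M : nat).
Variable (f : 'rV[R]_e -> R).
Hypotheses (T_gt0 : 0 < T) (beta_gt0 : 0 < beta).
Hypothesis f_C : classC N.+1 f.
Hypothesis idxIE : forall i : mindex e, idxI alpha beta i <-> (mdeg i < N)%N.
Hypothesis idxJE : forall j k : mindex e,
  idxJ alpha beta (j, k) <-> (mdeg j + mdeg k < M)%N.
Hypothesis MN : (M <= N)%N.
Local Notation V := 'rV[R]_e.
Local Notation path := (path_data R d e).
Local Notation L := (mlow e N.+1).
Implicit Types (X Y : path) (i k p q : mindex e).

Let beta_ge0 : 0 <= beta := ltW beta_gt0.

(** Componentwise form of the distance, with the same bound K for all the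
    components; as no sums occur it is what the estimates use. *)
Definition path_close X Y (K : R) := [/\ 0 <= K,
  forall s t, 0 <= s -> s < t -> t <= T -> forall l,
    `|hatX X s t 0 l - hatX Y s t 0 l| <= K * (t - s) `^ beta,
  forall i, (mdeg i < N)%N -> forall s t, 0 <= s -> s < t -> t <= T -> forall a,
    `|fstX X i s t 0 a - fstX Y i s t 0 a| <= K * (t - s) `^ ((mdeg i)%:R * beta + alpha) &
  forall j k, (mdeg j + mdeg k < M)%N -> forall s t, 0 <= s -> s < t -> t <= T -> forall a b,
    `|sndX X j k s t a b - sndX Y j k s t a b|
      <= K * (t - s) `^ ((mdeg (j + k))%:R * beta + 2 * alpha)].

Definition null_path : path :=
  PathData (fun _ _ => 0) (fun _ _ _ => 0) (fun _ _ _ _ => 0).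

(** Bounds on the components are expressed as closeness to the null path. *)
Definition bounded_path (K : R) X := [/\ chen_hat T X,
  chen_fst T alpha beta X, chen_snd T alpha beta X & path_close X null_path K].

Lemma path_close_refl X : path_close X X 0.
Proof. by split=> // *; rewrite subrr normr0 mul0r. Qed.

Lemma path_close_ge0 X Y K : path_close X Y K -> 0 <= K.
Proof. by case. Qed.

Variable K : R.
Local Notation lipO2 := (lipO (bounded_path K) path_close (@dom2 R T) (@len2 R)).
Local Notation lipO3 := (lipO (bounded_path K) path_close (@dom3 R T) (@len3 R)).

Lemma lipO_hat l : lipO2 beta (fun X st => hatX X st.1 st.2 0 l).
Proof.
have K0 : 0 <= Num.max K 1 by rewrite le_max ler01 orbT.
exists (Num.max K 1) => // X Y eps [_ _ _ [_ hX _ _]] _ [eps0 hXY _ _] [s t] [s0 st tT].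
rewrite /len2 /=; split.
  have := hX s t s0 st tT l; rewrite mxE subr0 => /le_trans; apply.
  by apply: ler_wpM2r; rewrite ?powR_ge0 ?le_max ?lexx.
apply: (le_trans (hXY s t s0 st tT l)).
by apply: ler_wpM2r; rewrite ?powR_ge0 ?ler_peMl// le_max lexx orbT.
Qed.

Lemma lipO_fst i a : (mdeg i < N)%N ->
  lipO2 ((mdeg i)%:R * beta + alpha) (fun X st => fstX X i st.1 st.2 0 a).
Proof.
move=> iN; have K0 : 0 <= Num.max K 1 by rewrite le_max ler01 orbT.
exists (Num.max K 1) => // X Y eps [_ _ _ [_ _ hX _]] _ [eps0 _ hXY _] [s t] [s0 st tT].
rewrite /len2 /=; split.
  have := hX i iN s t s0 st tT a; rewrite mxE subr0 => /le_trans; apply.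
  by apply: ler_wpM2r; rewrite ?powR_ge0 ?le_max ?lexx.
apply: (le_trans (hXY i iN s t s0 st tT a)).
by apply: ler_wpM2r; rewrite ?powR_ge0 ?ler_peMl// le_max lexx orbT.
Qed.

Lemma lipO_snd j k a b : (mdeg j + mdeg k < M)%N ->
  lipO2 ((mdeg j + mdeg k)%:R * beta + 2 * alpha) (fun X st => sndX X j k st.1 st.2 a b).
Proof.
move=> jk; have K0 : 0 <= Num.max K 1 by rewrite le_max ler01 orbT.
exists (Num.max K 1) => // X Y eps [_ _ _ [_ _ _ hX]] _ [eps0 _ _ hXY] [s t] [s0 st tT].
rewrite /len2 /= -mdegD; split.
  have := hX j k jk s t s0 st tT a b; rewrite mxE subr0 => /le_trans; apply.
  by apply: ler_wpM2r; rewrite ?powR_ge0 ?le_max ?lexx.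
apply: (le_trans (hXY j k jk s t s0 st tT a b)).
by apply: ler_wpM2r; rewrite ?powR_ge0 ?ler_peMl// le_max lexx orbT.
Qed.

Lemma lipO_mmono i : lipO2 ((mdeg i)%:R * beta) (fun X st => mmono (hatX X st.1 st.2) i).
Proof.
rewrite /mmono /mpow -[X in lipO _ _ _ _ X](add0r).
apply: lipOM; [exact: path_close_refl|exact: path_close_ge0|exact: len2_bnd| |].
  by apply: lipO_cst; exact: path_close_ge0.
rewrite /mdeg natr_sum mulr_suml.
apply: (@lipO_prod R _ _ _ T path_close_refl path_close_ge0 _ _ _ (@len2_bnd R T)) => l.
apply: (@lipOX R _ _ _ T path_close_refl path_close_ge0 _ _ _ (@len2_bnd R T)).
exact: lipO_hat.
Qed.

Lemma hat_diag X s : bounded_path K X -> 0 <= s <= T -> hatX X s s = 0.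
Proof.
move=> [ch _ _ _] /andP[s0 sT]; have := ch s s s.
rewrite s0 lexx sT => /(_ isT isT) /eqP.
by rewrite -subr_eq0 opprD addrA subrr add0r oppr_eq0 => /eqP.
Qed.

Lemma xhatD X s t : bounded_path K X -> 0 <= s <= t -> t <= T ->
  xhat X t = xhat X s + hatX X s t.
Proof. by case=> ch _ _ _ /andP[s0 st] tT; apply: ch; rewrite ?lexx ?s0 ?st. Qed.

Lemma xhat_bound X Y eps s l : bounded_path K X -> bounded_path K Y ->
  path_close X Y eps -> 0 <= s <= T ->
  `|xhat X s 0 l| <= K * T `^ beta /\ `|xhat X s 0 l - xhat Y s 0 l| <= eps * T `^ beta.
Proof.
move=> bX bY [e0 hXY _ _] /andP[]; rewrite le_eqVlt => /predU1P[<- _|s0 sT].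
  have h0 : 0 <= (0 : R) <= T by rewrite lexx ltW.
  rewrite /xhat (hat_diag bX h0) (hat_diag bY h0) !mxE subr0 normr0.
  by case: bX => _ _ _ [K0 _ _ _]; split; apply: mulr_ge0 (powR_ge0 _ _).
case: (bX) => _ _ _ [K0 hX _ _].
have pT : (s - 0) `^ beta <= T `^ beta.
  by rewrite subr0; apply: ge0_ler_powR; rewrite ?nnegrE ?(ltW s0) ?(ltW T_gt0).
have := hX 0 s (lexx 0) s0 sT l; rewrite mxE subr0 => h1.
have h2 := hXY 0 s (lexx 0) s0 sT l.
by split; [apply: (le_trans h1)|apply: (le_trans h2)]; apply: ler_wpM2l.
Qed.

Lemma lipO_taylor_rem p m : (mdeg p + m <= N)%N ->
  lipO2 (m%:R * beta) (fun X st => taylor_rem N f p m (xhat X st.1) (hatX X st.1 st.2)).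
Proof.
move=> pmN; pose B := `|K| * T `^ beta + `|K|; pose H := T `^ beta.
have H0 : 0 <= H by exact: powR_ge0.
have B0 : 0 <= B by rewrite addr_ge0// mulr_ge0.
have [C C0 hC] := taylor_rem_bound f_C B0 H0 pmN.
exists (C * (1 + H)); first by rewrite mulr_ge0// addr_ge0.
move=> X Y eps bX bY cXY [s t] [/= s0 st tT].
have e0 := path_close_ge0 cXY.
have sT : 0 <= s <= T by rewrite s0 (le_trans (ltW st)).
rewrite /len2 /=.
have l0 : 0 < t - s by rewrite subr_gt0.
have K0 : 0 <= K by case: bX => _ _ _ [].
have pb : 0 <= (t - s) `^ beta by exact: powR_ge0.
have hB (Z : path) : bounded_path K Z -> forall j, `|hatX Z s t 0 j| <= B * (t - s) `^ beta.
  move=> [_ _ _ [_ hZ _ _]] j; have := hZ s t s0 st tT j; rewrite mxE subr0.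
  move=> /le_trans; apply; apply: ler_wpM2r => //.
  by rewrite /B ger0_norm// lerDr mulr_ge0.
have xB (Z : path) : bounded_path K Z -> forall j, `|xhat Z s 0 j| <= B.
  move=> bZ j; have [h _] := xhat_bound j bZ bZ (path_close_refl Z) sT.
  by apply: (le_trans h); rewrite /B ger0_norm// lerDl.
have etaH : (t - s) `^ beta <= H.
  by apply: ge0_ler_powR; rewrite ?nnegrE ?(ltW l0) ?(ltW T_gt0)//; lra.
have e1 : 0 <= eps * (1 + H) by rewrite mulr_ge0// addr_ge0.
have xx' j : `|xhat X s 0 j - xhat Y s 0 j| <= eps * (1 + H).
  have [_ h] := xhat_bound j bX bY cXY sT; apply: (le_trans h).
  by apply: ler_wpM2l => //; rewrite lerDr.
have hh' j : `|hatX X s t 0 j - hatX Y s t 0 j| <= eps * (1 + H) * (t - s) `^ beta.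
  case: cXY => _ h _ _; apply: (le_trans (h s t s0 st tT j)).
  by apply: ler_wpM2r => //; rewrite ler_peMr// lerDl.
have [b1 b2] := hC _ _ _ _ _ _ pb etaH e1 (xB _ bX) (xB _ bY) (hB _ bX) (hB _ bY) xx' hh'.
have pE : ((t - s) `^ beta) ^+ m = (t - s) `^ (m%:R * beta).
  by rewrite -powR_mulrn// -powRrM mulrC.
rewrite -pE; split.
  apply: (le_trans b1); apply: ler_wpM2r; first exact: exprn_ge0.
  by rewrite ler_peMr// lerDl.
by apply: (le_trans b2); rewrite (mulrAC C (1 + H)) -(mulrA C eps).
Qed.

Lemma lipO_mpartial p (S : Type) (dom : S -> Prop) (len : S -> R) (phi : S -> R) :
  (mdeg p < N)%N -> (forall s, dom s -> 0 <= phi s <= T) ->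
  lipO (bounded_path K) path_close dom len 0 (fun X s => mpartial p f (xhat X (phi s))).
Proof.
move=> pN ph; have gC := mpartial_classC1 f_C (ltnW pN).
pose B := `|K| * T `^ beta.
have [C1 C10 b1] := bounded_on_box B (classC_continuous gC).
have [C2 C20 b2] := lipschitz_on_box B gC.
have H0 : 0 <= T `^ beta by exact: powR_ge0.
exists (C1 + C2 * T `^ beta); first by rewrite addr_ge0// mulr_ge0.
move=> X Y eps bX bY cXY s /ph sT; rewrite powRr0 !mulr1.
have K0 : 0 <= K by case: bX => _ _ _ [].
have e0 := path_close_ge0 cXY.
have xB (Z : path) : bounded_path K Z -> forall j, `|xhat Z (phi s) 0 j| <= B.
  move=> bZ j; have [h _] := xhat_bound j bZ bZ (path_close_refl Z) sT. by rewrite /B (ger0_norm K0).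
split.
  by apply: (le_trans (b1 _ (xB _ bX))); rewrite lerDl mulr_ge0.
apply: (@le_trans _ _ (C2 * (eps * T `^ beta))).
  apply: b2; [exact: xB|exact: xB|] => j.
  by have [_] := xhat_bound j bX bY cXY sT.
rewrite mulrDl -[leLHS]add0r; apply: lerD; first exact: mulr_ge0.
by rewrite -mulrA (mulrC eps).
Qed.


Lemma ler_lipO2 g g' (a : path -> R * R -> R) : g' <= g -> lipO2 g a -> lipO2 g' a.
Proof. by apply: lipO_weak; [exact: path_close_ge0|exact: len2_bnd]. Qed.

Lemma ler_lipO3 g g' (a : path -> R * R * R -> R) : g' <= g -> lipO3 g a -> lipO3 g' a.
Proof. by apply: lipO_weak; [exact: path_close_ge0|exact: len3_bnd]. Qed.

Lemma lipO2M g1 g2 a b : lipO2 g1 a -> lipO2 g2 b ->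
  lipO2 (g1 + g2) (fun X s => a X s * b X s).
Proof. by apply: lipOM; [exact: path_close_refl|exact: path_close_ge0|exact: len2_bnd]. Qed.

Lemma lipO3M g1 g2 a b : lipO3 g1 a -> lipO3 g2 b ->
  lipO3 (g1 + g2) (fun X s => a X s * b X s).
Proof. by apply: lipOM; [exact: path_close_refl|exact: path_close_ge0|exact: len3_bnd]. Qed.

Lemma lipO3_su g (a : path -> R * R -> R) : 0 <= g -> lipO2 g a ->
  lipO3 g (fun X s => a X (s.1.1, s.1.2)).
Proof. by apply: lipO_su; exact: path_close_ge0. Qed.

Lemma lipO3_ut g (a : path -> R * R -> R) : 0 <= g -> lipO2 g a ->
  lipO3 g (fun X s => a X (s.1.2, s.2)).
Proof. by apply: lipO_ut; exact: path_close_ge0. Qed.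

(** Chen's relation in the form used below: entrywise, with monomials divided by
    factorials and with sums over a list. *)
Lemma fst_chen X i a s u t : bounded_path K X -> (mdeg i < N)%N ->
  0 <= s <= u -> u <= t <= T ->
  fstX X i s t 0 a = fstX X i s u 0 a +
    \sum_(p <- L | mleb p i) mmono (hatX X s u) (msub i p) * fstX X p u t 0 a.
Proof.
move=> [_ cf _ _] iN su ut; rewrite (cf i _ s u t su ut); last exact/idxIE.
rewrite mxE; congr (_ + _).
rewrite (sum_mlow_fsbig (N := N.+1) (P := fun p => mleb p i)).
  by rewrite summxE; apply: eq_bigr => p _; rewrite mxE.
move=> p; split=> [pi|/andP[_ /mlebP//]].
rewrite mem_mlow; apply/andP; split; last exact/mlebP.
by rewrite (leq_ltn_trans (mdeg_mle pi))// ltnW.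
Qed.

Lemma snd_chen X j k a b s u t : bounded_path K X -> (mdeg j + mdeg k < M)%N ->
  0 <= s <= u -> u <= t <= T ->
  sndX X j k s t a b = sndX X j k s u a b +
    \sum_(q <- L | mleb q k) mmono (hatX X s u) (msub k q) *
      (fstX X j s u 0 a * fstX X q u t 0 b) +
    \sum_(p <- L | mleb p j) \sum_(q <- L | mleb q k)
      mmono (hatX X s u) (msub j p) * mmono (hatX X s u) (msub k q) * sndX X p q u t a b.
Proof.
move=> [_ _ cs _] jkM su ut; rewrite (cs j k _ s u t su ut); last exact/idxJE.
have below (m : mindex e) : (mdeg m < M)%N -> forall p, mle p m <-> (p \in L) && mleb p m.
  move=> mM p; split=> [pm|/andP[_ /mlebP//]].
  rewrite mem_mlow; apply/andP; split; last exact/mlebP.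
  by rewrite (leq_ltn_trans (mdeg_mle pm))// ltnW// ltnS (leq_trans _ MN).
have jM : (mdeg j < M)%N by apply: leq_ltn_trans jkM; exact: leq_addr.
have kM : (mdeg k < M)%N by apply: leq_ltn_trans jkM; exact: leq_addl.
rewrite !mxE; congr (_ + _ + _).
  rewrite (sum_mlow_fsbig (N := N.+1) (P := fun p => mleb p k)); last exact: below.
  rewrite summxE; apply: eq_bigr => q _.
  by rewrite mxE /tensor mxE big_ord1 mxE.
rewrite (sum_mlow_fsbig (N := N.+1) (P := fun p => mleb p j)); last exact: below.
rewrite summxE; apply: eq_bigr => p /mlebP pj.
rewrite (sum_mlow_fsbig (N := N.+1) (P := fun p => mleb p k)); last exact: below.
rewrite summxE; apply: eq_bigr => q /mlebP qk.
by rewrite mxE /mmono msubD// mpowD invfM; ring.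
Qed.

End PathEstimates.

(** * Additive defects of the germs *)
Section Defects.
Variables (R : realType) (d e : nat) (T alpha beta : R) (N M : nat).
Variable (f : 'rV[R]_e -> R).
Hypothesis idxIE : forall i : mindex e, idxI alpha beta i <-> (mdeg i < N)%N.
Hypothesis idxJE : forall j k : mindex e,
  idxJ alpha beta (j, k) <-> (mdeg j + mdeg k < M)%N.
Hypothesis MN : (M <= N)%N.
Variable K : R.
Local Notation path := (path_data R d e).
Local Notation L := (mlow e N.+1).
Local Notation good := (bounded_path T alpha beta N M K).
Local Notation rem := (taylor_rem N f).

Definition germ1 (X : path) a s t : R :=
  \sum_(i <- L | (mdeg i < N)%N) mpartial i f (xhat X s) * fstX X i s t 0 a.

Definition germ2 (X : path) a b s t : R :=
  \sum_(j <- L | (mdeg j < M)%N) \sum_(k <- L | (mdeg j + mdeg k < M)%N)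
    mpartial j f (xhat X s) * mpartial k f (xhat X s) * sndX X j k s t a b.

(** After insertion of Chen's relation, the coefficient of the component y q is the
    Taylor polynomial at x of the q-th derivative, that is, its value at x + h up
    to a remainder. *)
Lemma taylor_resum (m : nat) (x h : 'rV[R]_e) (y : mindex e -> R) : (m <= N)%N ->
  \sum_(k <- L | (mdeg k < m)%N) mpartial k f x *
     \sum_(q <- L | mleb q k) mmono h (msub k q) * y q =
  \sum_(q <- L | (mdeg q < m)%N)
     y q * (mpartial q f (x + h) - rem q (m - mdeg q) x h).
Proof.
move=> mN.
transitivity (\sum_(k <- L | (mdeg k < m)%N) \sum_(q <- L | mleb q k)
    mpartial (q + msub k q) f x * mmono h (msub k q) * y q).
  apply: eq_bigr => k _; rewrite mulr_sumr; apply: eq_bigr => q /mlebP qk.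
  by rewrite msubKC// mulrA.
rewrite (sum_chain (fun q i => mpartial (q + i) f x * mmono h i * y q)); last exact: leqW.
apply: eq_bigr => q _; rewrite /taylor_rem subKr /taylor mulrC mulr_suml.
by apply: eq_bigl => i; rewrite ltn_subRL.
Qed.

Section OnePath.
Variables (X : path) (s u t : R).
Hypotheses (gX : good X) (s_ge0 : 0 <= s) (su : s < u) (ut : u < t) (tT : t <= T).
Let D j := mpartial j f (xhat X s).
Let E j := mpartial j f (xhat X u).
Let h := hatX X s u.
Let rho p m := rem p m (xhat X s) h.

Let su_le : 0 <= s <= u. Proof. by rewrite s_ge0 ltW. Qed.
Let ut_le : u <= t <= T. Proof. by rewrite ltW. Qed.

Let xu : xhat X s + h = xhat X u.
Proof. by rewrite (xhatD gX su_le)// (le_trans _ tT)// ltW. Qed.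

(** Chen's relation produces on [u, t] the germ with Taylor polynomials in place of the
    derivatives at time u; only the remainders are left. *)
Lemma germ1_defect a : germ1 X a s t - germ1 X a s u - germ1 X a u t =
  - \sum_(p <- L | (mdeg p < N)%N) fstX X p u t 0 a * rho p (N - mdeg p).
Proof.
have -> : germ1 X a s t = germ1 X a s u +
    \sum_(q <- L | (mdeg q < N)%N) fstX X q u t 0 a * (E q - rho q (N - mdeg q)).
  rewrite /E -xu -taylor_resum// /germ1 -big_split; apply: eq_bigr => i iN /=.
  by rewrite -mulrDr (fst_chen idxIE a gX iN su_le ut_le).
rewrite [germ1 X a s u + _]addrC addrK /germ1 -sumrB -sumrN; apply: eq_bigr => p _.
by rewrite mulrBr mulrC addrAC subrr add0r.
Qed.

(** The first sum is the part of the product of the first level germs with indices in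
    J. The second sum holds its Taylor remainders. The other two sums stem from the
    components X^(pq) on [u, t], where two Taylor polynomials, truncated at a common
    total degree, are replaced one after the other by values at time u: first the one
    of the q-th derivative, then the one of the p-th derivative. *)
Lemma germ2_defect a b : germ2 X a b s t - germ2 X a b s u - germ2 X a b u t =
  \sum_(j <- L | (mdeg j < M)%N) \sum_(q <- L | (mdeg j + mdeg q < M)%N)
     D j * fstX X j s u 0 a * (E q * fstX X q u t 0 b)
  - (\sum_(j <- L | (mdeg j < M)%N) \sum_(q <- L | (mdeg j + mdeg q < M)%N)
       D j * fstX X j s u 0 a * (fstX X q u t 0 b * rho q (M - mdeg j - mdeg q)))
  - (\sum_(p <- L | (mdeg p < M)%N) \sum_(i <- L | (mdeg p + mdeg i < M)%N)
       \sum_(q <- L | (mdeg (p + i)%R + mdeg q < M)%N)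
         D (p + i)%R * mmono h i * (sndX X p q u t a b * rho q (M - mdeg (p + i)%R - mdeg q)))
  - (\sum_(p <- L | (mdeg p < M)%N) \sum_(q <- L | (mdeg p + mdeg q < M)%N)
       sndX X p q u t a b * E q * rho p (M - mdeg q - mdeg p)).
Proof.
pose w j k := \sum_(q <- L | mleb q k) mmono h (msub k q) *
  (fstX X j s u 0 a * fstX X q u t 0 b).
pose v j k := \sum_(p <- L | mleb p j) \sum_(q <- L | mleb q k)
  mmono h (msub j p) * mmono h (msub k q) * sndX X p q u t a b.
have chen : germ2 X a b s t = germ2 X a b s u +
    \sum_(j <- L | (mdeg j < M)%N) \sum_(k <- L | (mdeg j + mdeg k < M)%N) D j * D k * w j k +
    \sum_(j <- L | (mdeg j < M)%N) \sum_(k <- L | (mdeg j + mdeg k < M)%N) D j * D k * v j k.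
  rewrite /germ2 -!big_split; apply: eq_bigr => j _; rewrite -!big_split.
  apply: eq_bigr => k jk /=.
  by rewrite (snd_chen idxJE MN a b gX jk su_le ut_le) -!mulrDr.
have wE : \sum_(j <- L | (mdeg j < M)%N) \sum_(k <- L | (mdeg j + mdeg k < M)%N) D j * D k * w j k =
    \sum_(j <- L | (mdeg j < M)%N) \sum_(q <- L | (mdeg j + mdeg q < M)%N)
     D j * fstX X j s u 0 a * (E q * fstX X q u t 0 b)
    - \sum_(j <- L | (mdeg j < M)%N) \sum_(q <- L | (mdeg j + mdeg q < M)%N)
       D j * fstX X j s u 0 a * (fstX X q u t 0 b * rho q (M - mdeg j - mdeg q)).
  rewrite -sumrB; apply: eq_bigr => j _.
  have cond (q : mindex e) : (mdeg j + mdeg q < M)%N = (mdeg q < M - mdeg j)%N by rewrite ltn_subRL.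
  rewrite !(eq_bigl _ _ cond).
  have := @taylor_resum (M - mdeg j) (xhat X s) h
    (fun q => D j * fstX X j s u 0 a * fstX X q u t 0 b) (leq_trans (leq_subr _ _) MN).
  rewrite xu => resum; transitivity (\sum_(q <- L | (mdeg q < M - mdeg j)%N)
     D j * fstX X j s u 0 a * fstX X q u t 0 b * (E q - rho q (M - mdeg j - mdeg q))).
    rewrite -resum; apply: eq_bigr => k _; rewrite /w !mulr_sumr.
    by apply: eq_bigr => q _; rewrite /D; ring.
  by rewrite -sumrB; apply: eq_bigr => q _; ring.
have vE : \sum_(j <- L | (mdeg j < M)%N) \sum_(k <- L | (mdeg j + mdeg k < M)%N) D j * D k * v j k =
    \sum_(p <- L | (mdeg p < M)%N) \sum_(i <- L | (mdeg p + mdeg i < M)%N)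
       \sum_(q <- L | (mdeg (p + i)%R + mdeg q < M)%N)
         D (p + i)%R * mmono h i *
           (sndX X p q u t a b * (E q - rho q (M - mdeg (p + i)%R - mdeg q))).
  rewrite -(sum_chain (fun p i => \sum_(q <- L | (mdeg (p + i)%R + mdeg q < M)%N)
    D (p + i)%R * mmono h i *
      (sndX X p q u t a b * (E q - rho q (M - mdeg (p + i)%R - mdeg q))))); last exact: leqW.
  apply: eq_bigr => j _.
  transitivity (\sum_(p <- L | mleb p j) \sum_(k <- L | (mdeg j + mdeg k < M)%N)
     D j * D k * \sum_(q <- L | mleb q k)
       mmono h (msub j p) * mmono h (msub k q) * sndX X p q u t a b).
    by rewrite exchange_big; apply: eq_bigr => k _; rewrite /v mulr_sumr.
  apply: eq_bigr => p /mlebP pj; rewrite msubKC//.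
  have cond (q : mindex e) : (mdeg j + mdeg q < M)%N = (mdeg q < M - mdeg j)%N by rewrite ltn_subRL.
  rewrite !(eq_bigl _ _ cond).
  have := @taylor_resum (M - mdeg j) (xhat X s) h
    (fun q => D j * mmono h (msub j p) * sndX X p q u t a b) (leq_trans (leq_subr _ _) MN).
  rewrite xu => resum; transitivity (\sum_(q <- L | (mdeg q < M - mdeg j)%N)
     D j * mmono h (msub j p) * sndX X p q u t a b * (E q - rho q (M - mdeg j - mdeg q))).
    rewrite -resum; apply: eq_bigr => k _; rewrite !mulr_sumr.
    by apply: eq_bigr => q _; rewrite /D; ring.
  by apply: eq_bigr => q _; rewrite !mulrA.
have taylorE p q : (mdeg p + mdeg q < M)%N ->
    \sum_(i <- L | (mdeg (p + i)%R + mdeg q < M)%N) D (p + i)%R * mmono h i =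
    E p - rho p (M - mdeg q - mdeg p).
  move=> _; rewrite /E -xu /rho /taylor_rem subKr /taylor; apply: eq_bigl => i.
  by rewrite mdegD !ltn_subRL [(mdeg p + mdeg i)%N]addnC addnC addnA addnAC [(mdeg q + _)%N]addnC.
rewrite chen wE vE.
have split_v : \sum_(p <- L | (mdeg p < M)%N) \sum_(i <- L | (mdeg p + mdeg i < M)%N)
       \sum_(q <- L | (mdeg (p + i)%R + mdeg q < M)%N)
         D (p + i)%R * mmono h i *
           (sndX X p q u t a b * (E q - rho q (M - mdeg (p + i)%R - mdeg q))) =
    (germ2 X a b u t - \sum_(p <- L | (mdeg p < M)%N) \sum_(q <- L | (mdeg p + mdeg q < M)%N)
       sndX X p q u t a b * E q * rho p (M - mdeg q - mdeg p))
   - (\sum_(p <- L | (mdeg p < M)%N) \sum_(i <- L | (mdeg p + mdeg i < M)%N)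
       \sum_(q <- L | (mdeg (p + i)%R + mdeg q < M)%N)
         D (p + i)%R * mmono h i * (sndX X p q u t a b * rho q (M - mdeg (p + i)%R - mdeg q))).
  rewrite /germ2 -!sumrB; apply: eq_bigr => p _.
  transitivity (\sum_(i <- L | (mdeg p + mdeg i < M)%N)
     \sum_(q <- L | (mdeg (p + i)%R + mdeg q < M)%N) D (p + i)%R * mmono h i * (sndX X p q u t a b * E q)
   - \sum_(i <- L | (mdeg p + mdeg i < M)%N)
       \sum_(q <- L | (mdeg (p + i)%R + mdeg q < M)%N)
         D (p + i)%R * mmono h i * (sndX X p q u t a b * rho q (M - mdeg (p + i)%R - mdeg q))).
    rewrite -sumrB; apply: eq_bigr => i _; rewrite -sumrB.
    by apply: eq_bigr => q _; rewrite -mulrBr -mulrBr.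
  congr (_ - _); rewrite -sumrB.
  rewrite (exchange_big_dep (fun q => (mdeg p + mdeg q < M)%N)) /=; last first.
    move=> i q _; apply: leq_ltn_trans; rewrite leq_add2r mdegD; exact: leq_addr.
  apply: eq_bigr => q pq.
  rewrite (eq_bigl (fun i => (mdeg (p + i)%R + mdeg q < M)%N)); last first.
    move=> i; rewrite andb_idl// mdegD; apply: leq_ltn_trans; exact: leq_addr.
  by rewrite -mulr_suml taylorE// -/(E p) -/(E q); ring.
by rewrite split_v; ring.
Qed.

End OnePath.
End Defects.

(** * The two levels of the integral *)
Section Integrals.
Variables (R : realType) (d e : nat) (T alpha beta : R) (N M : nat).
Variable (f : 'rV[R]_e -> R).
Hypotheses (T_gt0 : 0 < T) (alpha_gt0 : 0 < alpha) (beta_gt0 : 0 < beta).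
Hypothesis f_C : classC N.+1 f.
Hypothesis idxIE : forall i : mindex e, idxI alpha beta i <-> (mdeg i < N)%N.
Hypothesis idxJE : forall j k : mindex e,
  idxJ alpha beta (j, k) <-> (mdeg j + mdeg k < M)%N.
Hypothesis MN : (M <= N)%N.
Hypothesis theta1_gt1 : 1 < N%:R * beta + alpha.
Hypothesis theta2_gt1 : 1 < M%:R * beta + 2 * alpha.
Variable K : R.
Local Notation path := (path_data R d e).
Local Notation L := (mlow e N.+1).
Local Notation good := (bounded_path T alpha beta N M K).
Local Notation close := (path_close T alpha beta N M).
Local Notation rem := (taylor_rem N f).
Local Notation lipO2 := (lipO good close (@dom2 R T) (@len2 R)).
Local Notation lipO3 := (lipO good close (@dom3 R T) (@len3 R)).
Local Notation theta1 := (N%:R * beta + alpha).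
Local Notation theta2 := (M%:R * beta + 2 * alpha).
Local Notation xi1 := (germ1 N f).
Local Notation xi2 := (germ2 N M f).
Implicit Types (a b : 'I_d) (X Y : path).

Let degree_ge0 m c : 0 <= c -> 0 <= m%:R * beta + c.
Proof. by move=> c0; rewrite addr_ge0// mulr_ge0// ltW. Qed.

Let degree0_ge0 m : 0 <= m%:R * beta.
Proof. by rewrite mulr_ge0// ltW. Qed.

Let alpha_ge0 : 0 <= alpha := ltW alpha_gt0.
Let alpha2_ge0 : 0 <= 2 * alpha. Proof. by rewrite mulr_ge0. Qed.

Let close_ge0 (X Y : path) eps : close X Y eps -> 0 <= eps.
Proof. exact: path_close_ge0. Qed.

Let dom3_s (s : R * R * R) : dom3 T s -> 0 <= s.1.1 <= T.
Proof. by case: s => [[s u] t] [/= ? ? ? ?]; apply/andP; split; lra. Qed.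

Let dom3_u (s : R * R * R) : dom3 T s -> 0 <= s.1.2 <= T.
Proof. by case: s => [[s u] t] [/= ? ? ? ?]; apply/andP; split; lra. Qed.

Let dom2_s (s : R * R) : dom2 T s -> 0 <= s.1 <= T.
Proof. by case: s => [s t] [/= ? ? ?]; apply/andP; split; lra. Qed.

Lemma lipO_germ1 a : lipO2 alpha (fun X st => xi1 X a st.1 st.2).
Proof.
rewrite /germ1; apply: lipO_sum => i _ iN.
apply: (@ler_lipO2 _ _ _ _ _ _ _ _ _ (0 + ((mdeg i)%:R * beta + alpha))).
  by rewrite add0r lerDr.
apply: lipO2M; last exact: lipO_fst.
exact: lipO_mpartial.
Qed.

Lemma lipO_germ2 a b : lipO2 (2 * alpha) (fun X st => xi2 X a b st.1 st.2).
Proof.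
rewrite /germ2; apply: lipO_sum => j _ jM.
apply: lipO_sum => k _ jkM.
have kM : (mdeg k < M)%N by apply: leq_ltn_trans jkM; exact: leq_addl.
apply: (@ler_lipO2 _ _ _ _ _ _ _ _ _ (0 + 0 + ((mdeg j + mdeg k)%:R * beta + 2 * alpha))).
  by rewrite !add0r lerDr.
apply: lipO2M; last exact: lipO_snd.
by apply: lipO2M; apply: lipO_mpartial => //; exact: leq_trans MN.
Qed.

(** The order of a component of degree |p| and the order of the remainder that
    multiplies it add up to theta1 for every p. *)
Lemma lipO_germ1_defect a : lipO3 theta1
  (fun X s => xi1 X a s.1.1 s.2 - xi1 X a s.1.1 s.1.2 - xi1 X a s.1.2 s.2).
Proof.
apply: (lipO_ext (a := fun X s => - \sum_(p <- L | (mdeg p < N)%N)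
    fstX X p s.1.2 s.2 0 a * rem p (N - mdeg p) (xhat X s.1.1) (hatX X s.1.1 s.1.2)));
  last first.
  move=> X [[s u] t] gX [/= s0 su ut tT].
  exact: (germ1_defect f idxIE gX s0 su ut tT).
apply: lipON; apply: lipO_sum => p _ pN.
have -> : theta1 = ((mdeg p)%:R * beta + alpha) + (N - mdeg p)%:R * beta.
  by rewrite natrB ?(ltnW pN)//; ring.
apply: lipO3M.
  exact: (lipO3_ut (degree_ge0 _ alpha_ge0) (lipO_fst T alpha beta M K a pN)).
have pm : (mdeg p + (N - mdeg p) <= N)%N by rewrite subnKC// ltnW.
exact: (lipO3_su (degree0_ge0 _) (lipO_taylor_rem d alpha M T_gt0 beta_gt0 f_C K pm)).
Qed.

Definition int1 (X : path) a s t := sewing (xi1 X a) s t.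

Lemma sewable1 X a s t : good X -> 0 <= s -> s <= t -> t <= T -> sewable (xi1 X a) s t.
Proof.
move=> gX s0 st tT.
exact: (@sewable_family _ _ _ _ T (@path_close_refl _ _ _ _ _ _ _ _)
  (fun X _ => xi1 X a) _ _ theta1_gt1 _ (lipO_germ1_defect a) X 0).
Qed.

Lemma int1D X a s u t : good X -> 0 <= s -> s <= u -> u <= t -> t <= T ->
  int1 X a s t = int1 X a s u + int1 X a u t.
Proof.
move=> gX s0 su ut tT.
by apply: sewing_additive => //; apply: sewable1 => //; lra.
Qed.

Lemma lipO_int1_germ a : lipO2 theta1 (fun X st => int1 X a st.1 st.2 - xi1 X a st.1 st.2).
Proof.
exact: (@lipO_sewing _ _ _ _ T (@path_close_refl _ _ _ _ _ _ _ _) close_ge0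
  (fun X _ => xi1 X a) _ _ theta1_gt1 _ (lipO_germ1_defect a)).
Qed.

Let theta1_alpha : alpha <= theta1.
Proof. by rewrite lerDr. Qed.

Lemma lipO_int1 a : lipO2 alpha (fun X st => int1 X a st.1 st.2).
Proof.
apply: lipO_ext; first exact: lipOD (ler_lipO2 theta1_alpha (lipO_int1_germ a)) (lipO_germ1 a).
by move=> X st _ _ /=; rewrite subrK.
Qed.

(** The Riemann sums of the second level involve the first level from the start r of
    the partition; as a germ on [s, t] they therefore depend on a base point. *)
Definition based_germ2 (X : path) a b r s t :=
  int1 X a r s * int1 X b s t + xi2 X a b s t.

Definition defect2 (X : path) a b (s : R * R * R) :=
  xi2 X a b s.1.1 s.2 - xi2 X a b s.1.1 s.1.2 - xi2 X a b s.1.2 s.2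
  - int1 X a s.1.1 s.1.2 * int1 X b s.1.2 s.2.

(** Additivity of the first level makes the base point disappear from the defect. *)
Lemma based_germ2_defect X a b r s u t : good X -> 0 <= r -> r <= s -> s < u -> u < t -> t <= T ->
  based_germ2 X a b r s t - based_germ2 X a b r s u - based_germ2 X a b r u t
    = defect2 X a b (s, u, t).
Proof.
move=> gX r0 rs su ut tT; rewrite /based_germ2 /defect2 /=.
rewrite (@int1D X b s u t)//; [|lra|lra|lra].
rewrite (@int1D X a r s u)//; [ring|lra|lra].
Qed.

(** In each of the sums of [germ2_defect] the degree of the remainder complements the
    degrees of the other factors to M. The product of the first level integrals
    equals the product of the germs up to terms of order theta1 + alpha, and the
    product of the germs equals the first sum of [germ2_defect] up to terms of
    degree at least M. *)
Lemma lipO_defect2 a b : lipO3 theta2 (fun X s => defect2 X a b s).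
Proof.
pose D p (X : path) (s : R * R * R) := mpartial p f (xhat X s.1.1).
pose E p (X : path) (s : R * R * R) := mpartial p f (xhat X s.1.2).
pose xs i (X : path) (s : R * R * R) := fstX X i s.1.1 s.1.2 0 a.
pose y i (X : path) (s : R * R * R) := fstX X i s.1.2 s.2 0 b.
pose z p q (X : path) (s : R * R * R) := sndX X p q s.1.2 s.2 a b.
pose mu i (X : path) (s : R * R * R) := mmono (hatX X s.1.1 s.1.2) i.
pose rho p m (X : path) (s : R * R * R) := rem p m (xhat X s.1.1) (hatX X s.1.1 s.1.2).
pose za (X : path) (s : R * R * R) := int1 X a s.1.1 s.1.2 - xi1 X a s.1.1 s.1.2.
pose zb (X : path) (s : R * R * R) := int1 X b s.1.2 s.2 - xi1 X b s.1.2 s.2.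
pose xa (X : path) (s : R * R * R) := xi1 X a s.1.1 s.1.2.
pose xb (X : path) (s : R * R * R) := xi1 X b s.1.2 s.2.
have hD p : (mdeg p < N)%N -> lipO3 0 (D p) by move=> pN; exact: lipO_mpartial.
have hE p : (mdeg p < N)%N -> lipO3 0 (E p) by move=> pN; exact: lipO_mpartial.
have hxs i : (mdeg i < N)%N -> lipO3 ((mdeg i)%:R * beta + alpha) (xs i).
  by move=> iN; exact: (lipO3_su (degree_ge0 _ alpha_ge0) (lipO_fst T alpha beta M K a iN)).
have hy i : (mdeg i < N)%N -> lipO3 ((mdeg i)%:R * beta + alpha) (y i).
  by move=> iN; exact: (lipO3_ut (degree_ge0 _ alpha_ge0) (lipO_fst T alpha beta M K b iN)).
have hz p q : (mdeg p + mdeg q < M)%N -> lipO3 ((mdeg p + mdeg q)%:R * beta + 2 * alpha) (z p q).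
  by move=> pq; exact: (lipO3_ut (degree_ge0 _ alpha2_ge0) (lipO_snd T alpha beta N K a b pq)).
have hmu i : lipO3 ((mdeg i)%:R * beta) (mu i).
  exact: (lipO3_su (degree0_ge0 _) (lipO_mmono d T alpha beta N M K i)).
have hrho p m : (mdeg p + m <= N)%N -> lipO3 (m%:R * beta) (rho p m).
  by move=> pm; apply: (lipO3_su (degree0_ge0 _) (lipO_taylor_rem d alpha M T_gt0 beta_gt0 f_C K pm)).
have hza : lipO3 theta1 za.
  exact: (lipO3_su (degree_ge0 _ alpha_ge0) (lipO_int1_germ a)).
have hzb : lipO3 theta1 zb.
  exact: (lipO3_ut (degree_ge0 _ alpha_ge0) (lipO_int1_germ b)).
have hxa : lipO3 alpha xa by exact: (lipO3_su alpha_ge0 (lipO_germ1 a)).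
have hxb : lipO3 alpha xb by exact: (lipO3_ut alpha_ge0 (lipO_germ1 b)).
have MNR : M%:R * beta <= N%:R * beta by rewrite ler_pM2r// ler_nat.
have ltMN m : (m < M)%N -> (m < N)%N by move=> mM; exact: leq_trans MN.
pose G1 X s := \sum_(j <- L | (mdeg j < M)%N) \sum_(q <- L | (mdeg j + mdeg q < M)%N)
  D j X s * xs j X s * (y q X s * rho q (M - mdeg j - mdeg q)%N X s).
pose G2 X s := \sum_(p <- L | (mdeg p < M)%N) \sum_(i <- L | (mdeg p + mdeg i < M)%N)
  \sum_(q <- L | (mdeg (p + i)%R + mdeg q < M)%N)
  D (p + i)%R X s * mu i X s * (z p q X s * rho q (M - mdeg (p + i)%R - mdeg q)%N X s).
pose G3 X s := \sum_(p <- L | (mdeg p < M)%N) \sum_(q <- L | (mdeg p + mdeg q < M)%N)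
  z p q X s * E q X s * rho p (M - mdeg q - mdeg p)%N X s.
(* The product of the two germs has more terms than the expansion of the second
   level provides; the excess is of high order. *)
pose G4 X s := \sum_(j <- L | (mdeg j < N)%N)
  \sum_(q <- L | (mdeg q < N)%N && ~~ (mdeg j + mdeg q < M)%N)
  D j X s * xs j X s * (E q X s * y q X s).
have hG1 : lipO3 theta2 G1.
  apply: lipO_sum => j _ jM.
  apply: lipO_sum => q _ jqM.
  have qM : (mdeg q < M)%N by apply: leq_ltn_trans jqM; exact: leq_addl.
  have -> : theta2 = 0 + ((mdeg j)%:R * beta + alpha) +
     (((mdeg q)%:R * beta + alpha) + (M - mdeg j - mdeg q)%:R * beta).
    rewrite -subnDA natrB ?(ltnW jqM)// natrD; ring.
  apply: lipO3M; first by apply: lipO3M; [apply: hD|apply: hxs]; exact: ltMN.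
  apply: lipO3M; first by apply: hy; exact: ltMN.
  by apply: hrho; move: jqM MN; lia.
have hG2 : lipO3 theta2 G2.
  apply: lipO_sum => p _ pM.
  apply: lipO_sum => i _ piM.
  apply: lipO_sum => q _.
  rewrite mdegD => piqM.
  have -> : theta2 = 0 + (mdeg i)%:R * beta + (((mdeg p + mdeg q)%:R * beta + 2 * alpha) +
     (M - (mdeg p + mdeg i) - mdeg q)%:R * beta).
    rewrite -subnDA natrB ?(ltnW piqM)// !natrD; ring.
  apply: lipO3M.
    by apply: lipO3M; [apply: hD; rewrite mdegD; exact: ltMN|exact: hmu].
  apply: lipO3M; first by apply: hz; move: piqM; lia.
  by apply: hrho; move: piqM MN; lia.
have hG3 : lipO3 theta2 G3.
  apply: lipO_sum => p _ pM.
  apply: lipO_sum => q _ pqM.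
  have qM : (mdeg q < M)%N by apply: leq_ltn_trans pqM; exact: leq_addl.
  have -> : theta2 = ((mdeg p + mdeg q)%:R * beta + 2 * alpha) + 0 +
     (M - mdeg q - mdeg p)%:R * beta.
    rewrite -subnDA natrB; last by rewrite addnC ltnW.
    by rewrite !natrD; ring.
  apply: lipO3M; first by apply: lipO3M; [exact: hz|apply: hE; exact: ltMN].
  by apply: hrho; move: pqM MN; lia.
have hG4 : lipO3 theta2 G4.
  apply: lipO_sum => j _ jN.
  apply: lipO_sum => q _ /andP[qN].
  rewrite -leqNgt => Mjq.
  apply: (@ler_lipO3 _ _ _ _ _ _ _ _ _ (0 + ((mdeg j)%:R * beta + alpha) +
     (0 + ((mdeg q)%:R * beta + alpha)))).
    have : M%:R * beta <= (mdeg j + mdeg q)%:R * beta by rewrite ler_pM2r// ler_nat.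
    by rewrite natrD; lra.
  by apply: lipO3M; apply: lipO3M; [exact: hD|exact: hxs|exact: hE|exact: hy].
have hZ : lipO3 theta2 (fun X s => za X s * zb X s + za X s * xb X s + xa X s * zb X s).
  have a0 := alpha_gt0; have N0 := degree0_ge0 N.
  apply: lipOD; first apply: lipOD.
  - by apply: (ler_lipO3 _ (lipO3M hza hzb)); lra.
  - by apply: (ler_lipO3 _ (lipO3M hza hxb)); lra.
  - by apply: (ler_lipO3 _ (lipO3M hxa hzb)); lra.
apply: lipO_ext; first exact: lipON (lipOD (lipOD (lipOD (lipOD hZ hG4) hG1) hG2) hG3).
move=> X s gX ds; rewrite /defect2.
have : xi2 X a b s.1.1 s.2 - xi2 X a b s.1.1 s.1.2 - xi2 X a b s.1.2 s.2 =
    \sum_(j <- L | (mdeg j < M)%N) \sum_(q <- L | (mdeg j + mdeg q < M)%N)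
       D j X s * xs j X s * (E q X s * y q X s) - G1 X s - G2 X s - G3 X s.
  case: s ds => [[s u] t] [/= s0 su ut tT].
  exact: (germ2_defect f idxJE MN gX s0 su ut tT a b).
move=> ->.
have : xa X s * xb X s = \sum_(j <- L | (mdeg j < M)%N) \sum_(q <- L | (mdeg j + mdeg q < M)%N)
       D j X s * xs j X s * (E q X s * y q X s) + G4 X s.
  transitivity (\sum_(j <- L | (mdeg j < N)%N) \sum_(q <- L | (mdeg j + mdeg q < M)%N)
       D j X s * xs j X s * (E q X s * y q X s) + G4 X s).
    rewrite /xa /germ1 mulr_suml /G4 -big_split /=; apply: eq_bigr => j _.
    rewrite /xb /germ1 mulr_sumr (bigID (fun q => (mdeg j + mdeg q < M)%N)) /=.
    congr (_ + _); apply: eq_bigl => q; apply: andb_idl => jqM.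
    by apply: ltMN; apply: leq_ltn_trans jqM; exact: leq_addl.
  congr (_ + _); rewrite (bigID (fun j => (mdeg j < M)%N)) /= [X in _ + X]big1 ?addr0.
    by apply: eq_bigl => j; apply: andb_idl; exact: ltMN.
  move=> j /andP[_ jM]; apply: big_pred0 => q; apply/negbTE; apply: contra jM.
  by apply: leq_ltn_trans; exact: leq_addr.
have -> : int1 X a s.1.1 s.1.2 = za X s + xa X s by rewrite subrK.
have -> : int1 X b s.1.2 s.2 = zb X s + xb X s by rewrite subrK.
move=> H; rewrite mulrDl !mulrDr H; ring.
Qed.

Definition int2 (X : path) a b s t := sewing (based_germ2 X a b s) s t.

Lemma sewable2 X a b r s t : good X -> 0 <= r -> r <= s -> s <= t -> t <= T ->
  sewable (based_germ2 X a b r) s t.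
Proof.
move=> gX r0 rs st tT.
exact: (@sewable_family _ _ _ _ T (@path_close_refl _ _ _ _ _ _ _ _)
  (fun X r => based_germ2 X a b r) _ _ theta2_gt1
  (fun X r s u t => @based_germ2_defect X a b r s u t) (lipO_defect2 a b) X r).
Qed.

(** On [u, t], the germ based at s exceeds the germ based at u by a multiple of the
    additive first level, whose Riemann sums are exact. *)
Lemma int2_chen X a b s u t : good X -> 0 <= s -> s <= u -> u <= t -> t <= T ->
  int2 X a b s t = int2 X a b s u + int2 X a b u t + int1 X a s u * int1 X b u t.
Proof.
move=> gX s0 su ut tT.
have -> : int2 X a b s t = int2 X a b s u + sewing (based_germ2 X a b s) u t.
  by apply: sewing_additive => //; apply: sewable2 => //; lra.
rewrite -addrA; congr (_ + _); apply/eqP; rewrite -subr_eq0 opprD addrA -normr_le0.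
have u0 : 0 <= u by lra.
apply: sewing_close => //; [exact: sewable2|exact: sewable2|] => r pr.
rewrite normr_le0 subr_eq0; apply/eqP.
have lr : last u r = t by case: pr => _ /eqP.
have : forall v, u <= v -> path.path <%R v r -> last v r <= T ->
    rsum (based_germ2 X a b s) v r - rsum (based_germ2 X a b u) v r
    = int1 X a s u * int1 X b v (last v r).
  elim: r {pr lr} => [|w r IH] v uv /=.
    by rewrite /int1 sewing_ss subrr mulr0.
  move=> /andP[vw pr] lT.
  have wl : w <= last w r.
    by apply: itv_partition_le; split; [exact: pr|exact: eqxx].
  have uw : u <= w by exact: le_trans (ltW vw).
  have IHw := IH w uw pr lT.
  rewrite (@int1D X b v w (last w r))//; [|lra|lra].
  rewrite mulrDr -IHw /based_germ2 (@int1D X a s u v)//; [ring|lra].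
by move=> /(_ u (lexx u)); rewrite lr; apply => //; case: pr.
Qed.

Lemma lipO_int2 a b : lipO2 (2 * alpha) (fun X st => int2 X a b st.1 st.2).
Proof.
have h := @lipO_sewing _ _ _ _ T (@path_close_refl _ _ _ _ _ _ _ _) close_ge0
  (fun X r => based_germ2 X a b r) _ _ theta2_gt1
  (fun X r s u t => @based_germ2_defect X a b r s u t) (lipO_defect2 a b).
have t2 : 2 * alpha <= theta2 by rewrite lerDr.
apply: lipO_ext; first exact: lipOD (ler_lipO2 t2 h) (lipO_germ2 a b).
move=> X [s t] _ _ /=; rewrite /based_germ2 /int1 sewing_ss mul0r add0r subrK.
by [].
Qed.

End Integrals.

(** * Entrywise limits and Holder norms *)
Section MatrixLimits.
Variable R : realType.

Lemma cvg_entrywise (I : Type) (F : set_system I) (FF : Filter F) m n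
    (g : I -> 'M[R]_(m, n)) (l : 'M[R]_(m, n)) :
  (forall i j, g x i j @[x --> F] --> l i j) -> g x @[x --> F] --> l.
Proof.
move=> h; apply/cvg_ballP => eps e0.
have : \forall x \near F, forall i j, ball (l i j) eps (g x i j).
  apply: filter_forall => i; apply: filter_forall => j.
  by have /cvg_ballP := h i j; apply.
by apply: filterS => x hx; split.
Qed.

End MatrixLimits.

Section HolderNorms.
Variables (R : realType) (T : R).
Hypothesis T_gt0 : 0 < T.

Lemma entry_le_euclid m n (A : 'M[R]_(m, n)) i j : `|A i j| <= euclid_norm A.
Proof.
rewrite /euclid_norm -sqrtr_sqr ler_sqrt.
  rewrite (bigD1 i)//= (bigD1 j)//= -addrA lerDl addr_ge0// ?sumr_ge0// => k _.
    exact: sqr_ge0.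
  by apply: sumr_ge0 => l _; exact: sqr_ge0.
by apply: sumr_ge0 => k _; apply: sumr_ge0 => l _; exact: sqr_ge0.
Qed.

Lemma euclid_le_entries m n (A : 'M[R]_(m, n)) c : 0 <= c ->
  (forall i j, `|A i j| <= c) -> euclid_norm A <= Num.sqrt (m * n)%:R * c.
Proof.
move=> c0 h; rewrite /euclid_norm -[X in _ * X](ger0_norm c0) -sqrtr_sqr -sqrtrM ?ler0n//.
apply: ler_wsqrtr.
apply: (@le_trans _ _ (\sum_(i < m) \sum_(j < n) c ^+ 2)).
  apply: ler_sum => i _; apply: ler_sum => j _.
  by rewrite -real_normK ?num_real// lerXn2r ?nnegrE.
by rewrite !sumr_const !card_ord -mulrnA mulr_natl mulnC.
Qed.

Lemma holder_le m n (gamma c : R) (A : R -> R -> 'M[R]_(m, n)) : 0 <= c ->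
  (forall s t, 0 <= s -> s < t -> t <= T -> forall i j, `|A s t i j| <= c * (t - s) `^ gamma) ->
  (holder T gamma A <= (Num.sqrt (m * n)%:R * c)%:E)%E.
Proof.
move=> c0 h; apply: ge_ereal_sup => _ [s [t [s0 st tT ->]]]; rewrite lee_fin.
have p0 : 0 < `|t - s| `^ gamma by rewrite powR_gt0// normr_gt0 subr_eq0 gt_eqF.
rewrite ler_pdivrMr// -mulrA; apply: euclid_le_entries; first by rewrite mulr_ge0// ltW.
have /ger0_norm -> : 0 <= t - s by rewrite subr_ge0 ltW.
exact: h.
Qed.

Lemma entry_le_holder m n (gamma c : R) (A : R -> R -> 'M[R]_(m, n)) :
  (holder T gamma A <= c%:E)%E ->
  forall s t, 0 <= s -> s < t -> t <= T -> forall i j, `|A s t i j| <= c * (t - s) `^ gamma.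
Proof.
move=> h s t s0 st tT i j; apply: (le_trans (entry_le_euclid _ i j)).
have p0 : 0 < (t - s) `^ gamma by rewrite powR_gt0// subr_gt0.
rewrite -ler_pdivrMr// -lee_fin; apply: le_trans h.
apply: ereal_sup_ubound; exists s, t; split=> //.
by have /ger0_norm -> : 0 <= t - s by rewrite subr_ge0 ltW.
Qed.

Lemma holder_ge0 m n (gamma : R) (A : R -> R -> 'M[R]_(m, n)) : (0 <= holder T gamma A)%E.
Proof.
apply: (@le_trans _ _ (euclid_norm (A 0 T) / `|T - 0| `^ gamma)%:E).
  by rewrite lee_fin divr_ge0 ?powR_ge0 ?sqrtr_ge0.
by apply: ereal_sup_ubound; exists 0, T; split.
Qed.

End HolderNorms.

Lemma fsbig_ge_term (R : realType) (I : choiceType) (A : set I) (F : I -> \bar R) i :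
  finite_set A -> (forall j, 0 <= F j)%E -> A i -> (F i <= \sum_(j \in A) F j)%E.
Proof.
move=> fA F0 Ai; rewrite fsbig_finite//= (bigD1_seq i)//=.
- by rewrite leeDl// sume_ge0.
- by rewrite in_fset_set// inE.
Qed.

Lemma fsbig_ge0 (R : realType) (I : choiceType) (A : set I) (F : I -> \bar R) :
  finite_set A -> (forall j, 0 <= F j)%E -> (0 <= \sum_(j \in A) F j)%E.
Proof. by move=> fA F0; rewrite fsbig_finite//=; exact: sume_ge0. Qed.

Lemma fsbig_lty (R : realType) (I : choiceType) (A : set I) (F : I -> \bar R) :
  finite_set A -> (forall j, A j -> F j < +oo)%E -> (\sum_(j \in A) F j < +oo)%E.
Proof.
move=> fA Fy; rewrite fsbig_finite//= big_seq; apply: lte_sum_pinfty => j.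
by rewrite in_fset_set// inE; exact: Fy.
Qed.

(** * Componentwise bounds from the homogeneous norm and the distance *)
Section Bounds.
Variables (R : realType) (d e : nat) (T alpha beta : R) (N M : nat).
Hypotheses (T_gt0 : 0 < T) (alpha_gt0 : 0 < alpha) (beta_gt0 : 0 < beta).
Hypothesis idxIE : forall i : mindex e, idxI alpha beta i <-> (mdeg i < N)%N.
Hypothesis idxJE : forall j k : mindex e,
  idxJ alpha beta (j, k) <-> (mdeg j + mdeg k < M)%N.
Local Notation path := (path_data R d e).
Implicit Types X Y : path.

Lemma poweR_root_le (h : \bar R) k n (B : R) : (0 <= h)%E -> (h < +oo)%E ->
  (h `^ (k.+1%:R^-1)%R <= B%:E)%E -> (k < n)%N -> (h <= (Num.max 1 B ^+ n)%:E)%E.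
Proof.
case: h => // x; rewrite lee_fin => x0 _; rewrite poweR_EFin !lee_fin => xB kn.
have -> : x = (x `^ k.+1%:R^-1) ^+ k.+1.
  by rewrite -powR_mulrn ?powR_ge0// -powRrM mulVf ?pnatr_eq0// powRr1.
have m1 : 1 <= Num.max 1 B by rewrite le_max lexx.
apply: (@le_trans _ _ (Num.max 1 B ^+ k.+1)); last exact: ler_weXn2l.
rewrite lerXn2r ?nnegrE ?powR_ge0 ?(le_trans ler01 m1)//.
by rewrite (le_trans xB)// le_max lexx orbT.
Qed.

Let finI : finite_set (@idxI R e alpha beta).
Proof. by apply: finite_idxI => //; exact: ltW. Qed.

Let finJ : finite_set (@idxJ R e alpha beta).
Proof. by apply: finite_idxJ => //; exact: ltW. Qed.

(** The roots in the homogeneous norm are undone by powers of degree at most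
    N + M + 2; one exponent is taken for all the indices. *)
Lemma bounded_path_of_hnorm X (B : R) : ab_rough_path T alpha beta X ->
  (ab_hnorm T alpha beta X <= B%:E)%E ->
  bounded_path T alpha beta N M (Num.max 1 B ^+ (N + M).+2) X.
Proof.
move=> [ch cf cs [h0 h1 h2]] hB; split=> //.
set K := Num.max 1 B ^+ _.
have m1 : 1 <= Num.max 1 B by rewrite le_max lexx.
pose S1 := (\sum_(i \in @idxI R e alpha beta) holder T ((mdeg i)%:R * beta + alpha)%R (fstX X i)
  `^ ((mdeg i).+1%:R^-1)%R)%E.
pose S2 := (\sum_(jk \in @idxJ R e alpha beta)
  holder T ((mdeg (jk.1 + jk.2)%R)%:R * beta + 2 * alpha)%R (sndX X jk.1 jk.2)
    `^ ((mdeg (jk.1 + jk.2)%R).+2%:R^-1)%R)%E.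
have S10 : (0 <= S1)%E by apply: fsbig_ge0 => // i; exact: poweR_ge0.
have S20 : (0 <= S2)%E by apply: fsbig_ge0 => // i; exact: poweR_ge0.
have hX0 : (0 <= holder T beta (hatX X))%E by exact: holder_ge0.
have {}hB : (holder T beta (hatX X) + S1 + S2 <= B%:E)%E by exact: hB.
have hat_le : (holder T beta (hatX X) <= B%:E)%E.
  by apply: le_trans hB; rewrite -addeA leeDl// adde_ge0.
have S1_le : (S1 <= B%:E)%E.
  by apply: le_trans hB; rewrite (addeC (holder _ _ _)) -addeA leeDl// adde_ge0.
have S2_le : (S2 <= B%:E)%E.
  by apply: le_trans hB; rewrite leeDr// adde_ge0.
split.
- by rewrite exprn_ge0// (le_trans ler01 m1).
- move=> s t s0 st tT l; rewrite mxE subr0; apply: (@entry_le_holder _ T _ _ _ _ (hatX X)) => //.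
  apply: (le_trans hat_le); rewrite lee_fin (@le_trans _ _ (Num.max 1 B))//.
    by rewrite le_max lexx orbT.
  by rewrite -[leLHS]expr1 ler_weXn2l.
- move=> i iN s t s0 st tT a; rewrite mxE subr0; apply: (@entry_le_holder _ T _ _ _ _ (fstX X i)) => //.
  have iI : idxI alpha beta i by exact/idxIE.
  apply: (poweR_root_le (holder_ge0 T_gt0 _ _) (h1 _ iI) (le_trans _ S1_le)).
    by apply: (@fsbig_ge_term _ _ _ (fun i => holder T ((mdeg i)%:R * beta + alpha)%R (fstX X i)
      `^ ((mdeg i).+1%:R^-1)%R)%E) => // j; exact: poweR_ge0.
  by rewrite (leq_trans iN)// -addnS ltnW// ltnS leq_addr.
move=> j k jkM s t s0 st tT a b; rewrite mxE subr0; apply: (@entry_le_holder _ T _ _ _ _ (sndX X j k)) => //.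
have jkJ : idxJ alpha beta (j, k) by exact/idxJE.
apply: (poweR_root_le (holder_ge0 T_gt0 _ _) (h2 _ jkJ) (le_trans _ S2_le)).
  by apply: (@fsbig_ge_term _ _ _ (fun jk => holder T ((mdeg (jk.1 + jk.2)%R)%:R * beta + 2 * alpha)%R
     (sndX X jk.1 jk.2) `^ ((mdeg (jk.1 + jk.2)%R).+2%:R^-1)%R)%E (j, k)) => // ?; exact: poweR_ge0.
by rewrite mdegD !ltnS (leq_trans (ltnW jkM))// leq_addl.
Qed.

Lemma ab_hnorm_fin X : ab_rough_path T alpha beta X ->
  exists B : R, (ab_hnorm T alpha beta X <= B%:E)%E.
Proof.
move=> [_ _ _ [h0 h1 h2]]; exists (fine (ab_hnorm T alpha beta X)).
rewrite fineK// ge0_fin_numE.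
  rewrite /ab_hnorm !lte_add_pinfty//.
    by apply: fsbig_lty => // i iI; apply: poweR_lty; exact: h1.
  by apply: fsbig_lty => // jk jkJ; apply: poweR_lty; exact: h2.
rewrite /ab_hnorm !adde_ge0//; first exact: holder_ge0.
  by apply: fsbig_ge0 => // i; exact: poweR_ge0.
by apply: fsbig_ge0 => // i; exact: poweR_ge0.
Qed.

Lemma path_close_of_dist X Y (eps : R) : (ab_dist T alpha beta X Y <= eps%:E)%E ->
  path_close T alpha beta N M X Y eps.
Proof.
move=> hB.
pose S1 := (\sum_(i \in @idxI R e alpha beta)
  dholder T ((mdeg i)%:R * beta + alpha)%R (fstX X i) (fstX Y i))%E.
pose S2 := (\sum_(jk \in @idxJ R e alpha beta)
  dholder T ((mdeg (jk.1 + jk.2)%R)%:R * beta + 2 * alpha)%R (sndX X jk.1 jk.2) (sndX Y jk.1 jk.2))%E.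
have dh0 m n g (A B : R -> R -> 'M[R]_(m, n)) : (0 <= dholder T g A B)%E by exact: holder_ge0.
have S10 : (0 <= S1)%E by exact: fsbig_ge0.
have S20 : (0 <= S2)%E by exact: fsbig_ge0.
have {}hB : (dholder T beta (hatX X) (hatX Y) + S1 + S2 <= eps%:E)%E by exact: hB.
have hat_le : (dholder T beta (hatX X) (hatX Y) <= eps%:E)%E.
  by apply: le_trans hB; rewrite -addeA leeDl// adde_ge0.
have S1_le : (S1 <= eps%:E)%E.
  by apply: le_trans hB; rewrite (addeC (dholder _ _ _ _)) -addeA leeDl// adde_ge0.
have S2_le : (S2 <= eps%:E)%E.
  by apply: le_trans hB; rewrite leeDr// adde_ge0.
have entryB m n (A B : 'M[R]_(m, n)) i j : A i j - B i j = (A - B) i j by rewrite !mxE.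
split.
- by rewrite -lee_fin; exact: le_trans hat_le.
- move=> s t s0 st tT l; rewrite entryB.
  exact: (entry_le_holder hat_le).
- move=> i iN s t s0 st tT a; rewrite entryB.
  have iI : idxI alpha beta i by exact/idxIE.
  apply: (@entry_le_holder _ T _ _ _ _ (fun s t => fstX X i s t - fstX Y i s t)) => //.
  apply: le_trans S1_le.
  exact: (@fsbig_ge_term _ _ _ (fun i => dholder T ((mdeg i)%:R * beta + alpha)%R (fstX X i) (fstX Y i))).
move=> j k jkM s t s0 st tT a b; rewrite entryB.
have jkJ : idxJ alpha beta (j, k) by exact/idxJE.
apply: (@entry_le_holder _ T _ _ _ _ (fun s t => sndX X j k s t - sndX Y j k s t)) => //.
apply: le_trans S2_le.
exact: (@fsbig_ge_term _ _ _ (fun jk => dholder T ((mdeg (jk.1 + jk.2)%R)%:R * beta + 2 * alpha)%R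
     (sndX X jk.1 jk.2) (sndX Y jk.1 jk.2)) (j, k)).
Qed.

End Bounds.

(** Passing from entries to norms requires one constant for all the entries. *)
Lemma lipO_uniform (R : realType) (P : Type) (good : P -> Prop) (close : P -> P -> R -> Prop)
    (S : Type) (dom : S -> Prop) (len : S -> R) (g : R) (I : finType) (F : I -> P -> S -> R) :
  (forall X Y eps, close X Y eps -> 0 <= eps) ->
  (forall i, lipO good close dom len g (F i)) ->
  exists2 C, 0 <= C & forall X Y eps, good X -> good Y -> close X Y eps ->
    forall s, dom s -> forall i, `|F i X s| <= C * len s `^ g /\
      `|F i X s - F i Y s| <= C * eps * len s `^ g.
Proof.
move=> e0 h.
have /choice[C CP] i : exists c, 0 <= c /\ forall X Y eps, good X -> good Y -> close X Y eps ->
    forall s, dom s -> `|F i X s| <= c * len s `^ g /\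
      `|F i X s - F i Y s| <= c * eps * len s `^ g.
  by case: (h i) => c c0 cP; exists c.
exists (\sum_i C i); first by apply: sumr_ge0 => i _; case: (CP i).
move=> X Y eps gX gY cXY s ds i; have [_ /(_ X Y eps gX gY cXY s ds)[b1 b2]] := CP i.
have le : C i <= \sum_i C i.
  by rewrite (bigD1 i)//= lerDl sumr_ge0// => k _; case: (CP k).
have p0 := powR_ge0 (len s) g; have e0' := e0 _ _ _ cXY.
split; first by apply: (le_trans b1); exact: ler_wpM2r.
by apply: (le_trans b2); apply: ler_wpM2r => //; exact: ler_wpM2r.
Qed.

(** * The rough path integral *)
Section RoughIntegral.
Variables (R : realType) (d e : nat) (T alpha beta : R) (N M : nat).
Variable (f : 'rV[R]_e -> R).
Hypotheses (T_gt0 : 0 < T) (alpha_gt0 : 0 < alpha) (beta_gt0 : 0 < beta).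
Hypothesis f_C : classC N.+1 f.
Hypothesis idxIE : forall i : mindex e, idxI alpha beta i <-> (mdeg i < N)%N.
Hypothesis idxJE : forall j k : mindex e,
  idxJ alpha beta (j, k) <-> (mdeg j + mdeg k < M)%N.
Hypothesis MN : (M <= N)%N.
Hypothesis theta1_gt1 : 1 < N%:R * beta + alpha.
Hypothesis theta2_gt1 : 1 < M%:R * beta + 2 * alpha.
Local Notation path := (path_data R d e).
Local Notation good := (bounded_path T alpha beta N M).
Local Notation close := (path_close T alpha beta N M).
Local Notation I1 := (int1 N f).
Local Notation I2 := (int2 N M f).
Implicit Types (X Y : path) (a b : 'I_d) (K : R).

Lemma riemann1E X a s r : riemann1 alpha beta f X s r 0 a = rsum (germ1 N f X a) s r.
Proof.
rewrite /riemann1 summxE -sum_pt; apply: eq_bigr => p _.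
rewrite (sum_mlow_fsbig (N := N.+1) (P := fun i => (mdeg i < N)%N)).
  by rewrite summxE; apply: eq_bigr => i _; rewrite mxE.
move=> i; rewrite mem_mlow; split=> [/idxIE iN|/andP[_ /idxIE//]].
by rewrite iN ltnW.
Qed.

Lemma cvg_riemann1 K X s t : good K X -> 0 <= s -> s <= t -> t <= T ->
  riemann1 alpha beta f X s r @[r --> mesh_to0 s t] --> \row_a I1 X a s t.
Proof.
move=> gX s0 st tT; apply: cvg_entrywise => i a; rewrite mxE.
rewrite (_ : (fun r => _) = rsum (germ1 N f X a) s); last first.
  by apply/funext => r; rewrite (ord1 i) riemann1E.
exact: (sewable1 T_gt0 alpha_gt0 beta_gt0 f_C idxIE theta1_gt1 gX s0 st tT).
Qed.

Lemma rough_integral1E K X s t : good K X -> 0 <= s -> s <= t -> t <= T ->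
  rough_integral1 alpha beta f X s t = \row_a I1 X a s t.
Proof.
move=> gX s0 st tT; have pF := mesh_to0_proper st.
by apply: cvg_lim; [exact: norm_hausdorff|exact: (cvg_riemann1 gX)].
Qed.

Lemma riemann2E K X a b s t r : good K X -> 0 <= s -> t <= T -> itv_partition s t r ->
  riemann2 alpha beta f X s r a b = rsum (based_germ2 N M f X a b s) s r.
Proof.
move=> gX s0 tT pr; rewrite /riemann2 summxE.
pose G u v := rough_integral1 alpha beta f X s u 0 a * rough_integral1 alpha beta f X u v 0 b
  + germ2 N M f X a b u v.
transitivity (rsum G s r).
  rewrite -sum_pt; apply: eq_bigr => p _; rewrite mxE; congr (_ + _).
    by rewrite /tensor mxE big_ord1 mxE.
  rewrite (sum_pairs_fsbig (N := N.+1) (m := M)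
    (fun j k => (mpartial j f (xhat X (pt s r p)) * mpartial k f (xhat X (pt s r p))) *:
      sndX X j k (pt s r p) (pt s r p.+1))) ?leqW//.
  rewrite summxE /germ2; apply: eq_bigr => j _; rewrite summxE.
  by apply: eq_bigr => k _; rewrite mxE.
apply: rsum_ext pr _ => u v su uv vt; rewrite /G /based_germ2.
rewrite (rough_integral1E gX s0 su); last by rewrite (le_trans uv)// (le_trans vt).
rewrite (rough_integral1E gX (le_trans s0 su) uv (le_trans vt tT)).
by rewrite !mxE.
Qed.

Lemma cvg_riemann2 K X s t : good K X -> 0 <= s -> s <= t -> t <= T ->
  riemann2 alpha beta f X s r @[r --> mesh_to0 s t] --> \matrix_(a, b) I2 X a b s t.
Proof.
move=> gX s0 st tT; apply: cvg_entrywise => a b; rewrite mxE.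
have c : rsum (based_germ2 N M f X a b s) s r @[r --> mesh_to0 s t] --> I2 X a b s t.
  exact: (sewable2 T_gt0 alpha_gt0 beta_gt0 f_C idxIE idxJE MN theta1_gt1 theta2_gt1
    gX s0 (lexx s) st tT).
apply: cvg_trans c; apply: near_eq_cvg.
have := near_mesh_to0 s t ltr01; apply: filterS => r /fine_itv_partition pr.
by rewrite (riemann2E _ _ gX s0 tT pr).
Qed.

Lemma rough_integral2E K X s t : good K X -> 0 <= s -> s <= t -> t <= T ->
  rough_integral2 alpha beta f X s t = \matrix_(a, b) I2 X a b s t.
Proof.
move=> gX s0 st tT; have pF := mesh_to0_proper st.
by apply: cvg_lim; [exact: norm_hausdorff|exact: (cvg_riemann2 gX)].
Qed.

Let close_ge0 X Y eps : close X Y eps -> 0 <= eps.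
Proof. exact: path_close_ge0. Qed.

Lemma int1_bound K : exists2 C, 0 <= C & forall X Y eps, good K X -> good K Y -> close X Y eps ->
  forall s t, 0 <= s -> s < t -> t <= T -> forall a, `|I1 X a s t| <= C * (t - s) `^ alpha /\
    `|I1 X a s t - I1 Y a s t| <= C * eps * (t - s) `^ alpha.
Proof.
have [C C0 h] := lipO_uniform close_ge0
  (lipO_int1 M T_gt0 alpha_gt0 beta_gt0 f_C idxIE theta1_gt1 K).
exists C => // X Y eps gX gY cXY s t s0 st tT a.
by have := h X Y eps gX gY cXY (s, t) _ a; apply.
Qed.

Lemma int2_bound K : exists2 C, 0 <= C & forall X Y eps, good K X -> good K Y -> close X Y eps ->
  forall s t, 0 <= s -> s < t -> t <= T -> forall a b, `|I2 X a b s t| <= C * (t - s) `^ (2 * alpha) /\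
    `|I2 X a b s t - I2 Y a b s t| <= C * eps * (t - s) `^ (2 * alpha).
Proof.
have [C C0 h] := lipO_uniform (I := ('I_d * 'I_d)%type) close_ge0
  (fun ab => lipO_int2 T_gt0 alpha_gt0 beta_gt0 f_C idxIE idxJE MN theta1_gt1 theta2_gt1 K ab.1 ab.2).
exists C => // X Y eps gX gY cXY s t s0 st tT a b.
by have := h X Y eps gX gY cXY (s, t) _ (a, b); apply.
Qed.

Lemma rough_integral_correct K X : good K X ->
  rough_integral_exists alpha beta f X T /\
  a_rough_path T alpha (rough_integral alpha beta f X).
Proof.
move=> gX; split.
  move=> s t [/= s0 st tT]; split; apply/cvg_ex.
    by exists (\row_a I1 X a s t); exact: (cvg_riemann1 gX).
  by exists (\matrix_(a, b) I2 X a b s t); exact: (cvg_riemann2 gX).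
have [C1 C10 h1] := int1_bound K; have [C2 C20 h2] := int2_bound K.
have cXX := path_close_refl T alpha beta N M X.
split=> /=.
- move=> s u t /andP[s0 su] /andP[ut tT].
  have u0 := le_trans s0 su; have st := le_trans su ut; have uT := le_trans ut tT.
  rewrite (rough_integral1E gX s0 st tT) (rough_integral1E gX s0 su uT)
    (rough_integral1E gX u0 ut tT).
  apply/rowP => a; rewrite !mxE.
  exact: (int1D T_gt0 alpha_gt0 beta_gt0 f_C idxIE theta1_gt1 _ gX).
- move=> s u t /andP[s0 su] /andP[ut tT].
  have u0 := le_trans s0 su; have st := le_trans su ut; have uT := le_trans ut tT.
  rewrite (rough_integral1E gX s0 su uT) (rough_integral1E gX u0 ut tT).
  rewrite (rough_integral2E gX s0 st tT) (rough_integral2E gX s0 su uT)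
    (rough_integral2E gX u0 ut tT).
  apply/matrixP => a b; rewrite /tensor !mxE big_ord1 !mxE.
  exact: (int2_chen T_gt0 alpha_gt0 beta_gt0 f_C idxIE idxJE MN theta1_gt1 theta2_gt1 _ _ gX).
- apply: le_lt_trans (ltry (Num.sqrt (1 * d)%:R * C1)).
  apply: holder_le => // s t s0 st tT i a.
  rewrite (rough_integral1E gX s0 (ltW st) tT) mxE.
  by have [] := h1 X X 0 gX gX cXX s t s0 st tT a.
- apply: le_lt_trans (ltry (Num.sqrt (d * d)%:R * C2)).
  apply: holder_le => // s t s0 st tT a b.
  rewrite (rough_integral2E gX s0 (ltW st) tT) mxE.
  by have [] := h2 X X 0 gX gX cXX s t s0 st tT a b.
Qed.

Lemma rough_integral_lipschitz K : exists2 C : R, 0 < C &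
  forall X Y eps, good K X -> good K Y -> close X Y eps ->
  (a_dist T alpha (rough_integral alpha beta f X) (rough_integral alpha beta f Y)
    <= (C * eps)%:E)%E.
Proof.
have [C1 C10 h1] := int1_bound K; have [C2 C20 h2] := int2_bound K.
(* The summand 1 makes the constant positive. *)
exists (Num.sqrt (1 * d)%:R * C1 + Num.sqrt (d * d)%:R * C2 + 1).
  by rewrite ltr_wpDl// addr_ge0// mulr_ge0// sqrtr_ge0.
move=> X Y eps gX gY cXY; have e0 := close_ge0 cXY.
apply: (@le_trans _ _ ((Num.sqrt (1 * d)%:R * (C1 * eps))%:E +
    (Num.sqrt (d * d)%:R * (C2 * eps))%:E)%E); last first.
  by rewrite -EFinD lee_fin !mulrA -mulrDl ler_wpM2r// lerDl.
apply: leeD.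
  apply: holder_le => [|s t s0 st tT i a]; first exact: mulr_ge0.
  rewrite /= (rough_integral1E gX s0 (ltW st) tT) (rough_integral1E gY s0 (ltW st) tT) !mxE.
  by have [] := h1 X Y eps gX gY cXY s t s0 st tT a.
apply: holder_le => [|s t s0 st tT a b]; first exact: mulr_ge0.
rewrite /= (rough_integral2E gX s0 (ltW st) tT) (rough_integral2E gY s0 (ltW st) tT) !mxE.
by have [] := h2 X Y eps gX gY cXY s t s0 st tT a b.
Qed.

End RoughIntegral.

(** * The index sets as degree bounds *)
Section DegreeBounds.
Variables (R : realType) (e : nat) (alpha beta : R).
Hypotheses (e_gt0 : (0 < e)%N) (beta_gt0 : 0 < beta).
Local Notation idxI := (@idxI R e alpha beta).
Local Notation idxJ := (@idxJ R e alpha beta).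

Lemma mdeg_surj m : exists i : mindex e, mdeg i = m.
Proof.
elim: m => [|m [i im]]; first by exists 0; exact: mdeg0.
by exists (i + mone (Ordinal e_gt0)); rewrite mdegD mdeg_mone im addn1.
Qed.

(** A multi-index of degree n + 1 exists as e > 0, and by maximality of n it lies
    outside I. *)
Lemma idxI_degree n : (exists2 i, idxI i & mdeg i = n) -> (forall i, idxI i -> (mdeg i <= n)%N) ->
  (forall i, idxI i <-> (mdeg i < n.+1)%N) /\ 1 < n.+1%:R * beta + alpha.
Proof.
move=> [i0 i0I i0n] n_max; split=> [i|].
  split=> [/n_max//|]; rewrite ltnS => i_n; apply: le_trans i0I.
  by rewrite lerD2r ler_wpM2r ?(ltW beta_gt0)// ler_nat i0n.
have [i iE] := mdeg_surj n.+1; rewrite ltNge; apply/negP => h.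
by have := n_max i; rewrite /Defs.idxI /= iE ltnn => /(_ h).
Qed.

Lemma idxJ_degree : alpha <= 2^-1 -> exists M,
  (forall j k, idxJ (j, k) <-> (mdeg j + mdeg k < M)%N) /\ 1 < M%:R * beta + 2 * alpha.
Proof.
move=> alpha_le; have x0 : 0 <= (1 - 2 * alpha) / beta by apply: divr_ge0; [lra|exact: ltW].
exists (Num.truncn ((1 - 2 * alpha) / beta)).+1; split=> [j k|].
  rewrite ltnS truncn_ge_nat// ler_pdivlMr// lerBrDr -mdegD; exact: iff_refl.
have := truncnS_gt ((1 - 2 * alpha) / beta); rewrite ltr_pdivrMr//; lra.
Qed.

(** A degree allowed in J is allowed in I, because alpha <= 2 alpha. *)
Lemma idxJ_degree_le N M : 0 < alpha ->
  (forall i, idxI i <-> (mdeg i < N)%N) -> (forall j k, idxJ (j, k) <-> (mdeg j + mdeg k < M)%N) ->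
  (M <= N)%N.
Proof.
move=> alpha0 IN JM; case: M JM => // m JM.
have [j jm] := mdeg_surj m; rewrite -jm; apply/IN.
have : idxJ (j, 0) by apply/JM; rewrite mdeg0 jm addn0.
rewrite /Defs.idxJ /Defs.idxI /= addr0; lra.
Qed.

End DegreeBounds.

Unset Implicit Arguments.

Theorem theorem2p6 (R : realType) (d e : nat) (T alpha beta : R)
    (d_gt0 : (0 < d)%N) (e_gt0 : (0 < e)%N) (T_gt0 : 0 < T)
    (alpha_gt : 3^-1 < alpha) (alpha_le : alpha <= 2^-1)
    (beta_gt0 : 0 < beta) (beta_lt : beta < 2^-1)
    (n : nat)
    (n_attained : exists2 i : mindex e, idxI alpha beta i & mdeg i = n)
    (n_max : forall i : mindex e, idxI alpha beta i -> (mdeg i <= n)%N)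
    (f : 'rV[R]_e -> R) (f_C : classC n.+2 f) :
  (forall X : path_data R d e, ab_rough_path T alpha beta X ->
     rough_integral_exists alpha beta f X T /\
     a_rough_path T alpha (rough_integral alpha beta f X)) /\
  (forall M : R, 0 < M -> exists2 C : R, 0 < C &
     forall V W : path_data R d e,
       ab_rough_path T alpha beta V -> (ab_hnorm T alpha beta V <= M%:E)%E ->
       ab_rough_path T alpha beta W -> (ab_hnorm T alpha beta W <= M%:E)%E ->
       (a_dist T alpha (rough_integral alpha beta f V)
                       (rough_integral alpha beta f W)
        <= C%:E * ab_dist T alpha beta V W)%E).
Proof.
have alpha_gt0 : 0 < alpha by lra.
have [IE theta1_gt1] := idxI_degree e_gt0 beta_gt0 n_attained n_max.
have [m [JE theta2_gt1]] := @idxJ_degree R e alpha beta beta_gt0 alpha_le.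
have mn := idxJ_degree_le e_gt0 alpha_gt0 IE JE.
split=> [X Xrp|B B0].
  have [B hB] := ab_hnorm_fin T_gt0 alpha_gt0 beta_gt0 Xrp.
  have gX := bounded_path_of_hnorm T_gt0 alpha_gt0 beta_gt0 IE JE Xrp hB.
  exact: rough_integral_correct gX.
pose K := Num.max 1 B ^+ (n.+1 + m).+2.
have [C C0 lip] := rough_integral_lipschitz d T_gt0 alpha_gt0 beta_gt0 f_C IE JE mn
  theta1_gt1 theta2_gt1 K.
exists C => // V W Vrp VB Wrp WB.
have gV := bounded_path_of_hnorm T_gt0 alpha_gt0 beta_gt0 IE JE Vrp VB.
have gW := bounded_path_of_hnorm T_gt0 alpha_gt0 beta_gt0 IE JE Wrp WB.
have close := @path_close_of_dist R d e T alpha beta _ _ T_gt0 alpha_gt0 beta_gt0 IE JE V W.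
case dist: (ab_dist T alpha beta V W) close => [eps| |] close.
- by rewrite -EFinM; apply: lip => //; exact: close.
(* If the distance is infinite, so is the right-hand side. *)
- by rewrite gt0_muley ?leey ?lte_fin.
(* A distance equal to -oo would make the paths close with eps = -1. *)
- by have /path_close_ge0 := close (- 1) (leNye _); rewrite oppr_ge0 ler10.
Qed.
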